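(* Let $A$ be an infinite dimensional simple separable unital C*-algebra, and let $\alpha \in \mathrm{Aut}(A)$ be tracially approximately inner. Then $\alpha_*(\eta) - \eta$ is infinitesimal for every $\eta \in K_0(A)$.
   Context: Tracial approximate innerness: for an infinite dimensional simple separable unital C*-algebra $A$, $\alpha \in \mathrm{Aut}(A)$ is tracially approximately inner if for every finite set $F \subset A$, every $\varepsilon > 0$, and every positive element $x \in A$ with $\|x\| = 1$, there exist $p_1, p_2, v \in A$ such that: (1) $p_1$ and $p_2$ are projections, $v^*v = p_1$, and $vv^* = \alpha(p_2)$; (2) $\|p_1 a - a p_1\| < \varepsilon$ and $\|p_2 a - a p_2\| < \varepsilon$ for all $a \in F$; (3) $\|v p_1 a p_1 v^* - \alpha(p_2 a p_2)\| < \varepsilon$ for all $a \in F$; (4) $1 - p_1$ and $1 - p_2$ are Murray-von Neumann equivalent to projections (possibly zero) in the hereditary subalgebra $\overline{xAx}$; (5) $\|p_1 x p_1\| > 1 - \varepsilon$ and $\|p_2 x p_2\| > 1 - \varepsilon$. Infinitesimal: $K_0(A)$ is (pre)ordered by $\eta \le \zeta$ iff $\zeta - \eta$ is the class of a projection in some matrix algebra over $A$, and has order unit $[1_A]$. An element $\eta \in K_0(A)$ is infinitesimal if $-m[1_A] \le n\eta \le m[1_A]$ for all $m, n \in \mathbb{N}$ with $m > 0$. The map $\alpha_* \colon K_0(A) \to K_0(A)$ is induced by $\alpha$. *)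

(* Defs.v *)
(* The real numbers are an arbitrary [R : realType], the complex numbers [R[i]]. *)
From HB Require Import structures.
From mathcomp Require Import all_boot all_order all_algebra.
From mathcomp Require Import complex.
From mathcomp Require Import all_classical all_reals all_analysis.

Set Implicit Arguments.
Unset Strict Implicit.
Unset Printing Implicit Defensive.

Import Order.TTheory GRing.Theory Num.Theory.
Import numFieldNormedType.Exports.

Local Open Scope classical_set_scope.
Local Open Scope quotient_scope.
Local Open Scope complex_scope.
Local Open Scope ring_scope.

(* A unital C*-algebra, on a carrier whose uniform structure is the one given
   by the norm.  The norm is real valued, and is not the library norm of a
   [normedModType R[i]], because the class hierarchy does not allow a type to be
   both a ring and a normed space unless it is a [numDomainType].  The
   underlying ring of an [algType] is nonzero. *)
HB.mixin Record isCStarAlgebra (R : realType) A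
    & GRing.Algebra R[i] A & Uniform A := {
  cnorm : A -> R ;
  star : A -> A ;
  ler_cnormD : forall x y : A, cnorm (x + y) <= cnorm x + cnorm y ;
  cnormZ : forall (c : R[i]) (x : A), (cnorm (c *: x))%:C = `|c| * (cnorm x)%:C ;
  cnorm0_eq0 : forall x : A, cnorm x = 0 -> x = 0 ;
  ler_cnormM : forall x y : A, cnorm (x * y) <= cnorm x * cnorm y ;
  cnorm_entourageE :
    entourage = entourage_ (fun (x : A) (e : R) (y : A) => cnorm (x - y) < e) ;
  cnorm_complete : forall F : set_system A,
    ProperFilter F -> cauchy F -> exists l : A, F --> l ;
  starD : forall x y : A, star (x + y) = star x + star y ;
  starZ : forall (c : R[i]) (x : A), star (c *: x) = Num.conj c *: star x ;
  starM : forall x y : A, star (x * y) = star y * star x ;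
  starK : involutive star ;
  cnorm_starM : forall x : A, cnorm (star x * x) = cnorm x ^+ 2
}.

#[short(type="cstarAlgType")]
HB.structure Definition CStarAlgebra (R : realType) :=
  {A of isCStarAlgebra R A & GRing.Algebra R[i] A & Uniform A}.

Record starAut (R : realType) (A : cstarAlgType R) := StarAut {
  starAut_fun :> {lrmorphism A -> A} ;
  starAut_star : forall x : A, starAut_fun (star x) = star (starAut_fun x) ;
  starAut_bij : bijective starAut_fun
}.

Section Elements.
Variables (R : realType) (A : cstarAlgType R).

Definition infinite_dimensional :=
  ~ exists (n : nat) (e : 'I_n -> A),
      forall a : A, exists c : 'I_n -> R[i], a = \sum_(i < n) c i *: e i.

Definition separable := exists D : set A, countable D /\ dense D.

Definition two_sided_ideal (I : set A) :=
  [/\ I 0, (forall x y, I x -> I y -> I (x + y)),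
      (forall a x, I x -> I (a * x)) & (forall a x, I x -> I (x * a))].

Definition simple :=
  forall I : set A, two_sided_ideal I -> closed I -> I = [set 0] \/ I = setT.

Definition invertible (x : A) := exists y : A, y * x = 1 /\ x * y = 1.

Definition spectrum (x : A) : set R[i] := [set z | ~ invertible (z%:A - x)].

(* [0 <= z] in [R[i]] says that [z] is real and nonnegative. *)
Definition positive (x : A) :=
  star x = x /\ spectrum x `<=` [set z | 0 <= z].

Definition is_projection (p : A) := star p = p /\ p * p = p.

Definition mvn_equiv (p q : A) :=
  exists w : A, star w * w = p /\ w * star w = q.

(* For positive [x], the hereditary subalgebra generated by [x]. *)
Definition hereditary (x : A) : set A := closure [set x * a * x | a in setT].

Definition tracially_approximately_inner (alpha : starAut A) :=
  forall (F : set A) (eps : R) (x : A),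
    finite_set F -> 0 < eps -> positive x -> cnorm x = 1 ->
  exists p1 p2 v : A,
    [/\ [/\ is_projection p1, is_projection p2,
            star v * v = p1 & v * star v = alpha p2],
        (forall a, F a -> cnorm (p1 * a - a * p1) < eps /\
                          cnorm (p2 * a - a * p2) < eps),
        (forall a, F a ->
           cnorm (v * p1 * a * p1 * star v - alpha (p2 * a * p2)) < eps),
        (exists q1 q2 : A,
           [/\ hereditary x q1 /\ is_projection q1,
               hereditary x q2 /\ is_projection q2,
               mvn_equiv (1 - p1) q1 & mvn_equiv (1 - p2) q2])
      & cnorm (p1 * x * p1) > 1 - eps /\ cnorm (p2 * x * p2) > 1 - eps].

End Elements.

Section StarMatrices.
Variables (R : realType) (A : cstarAlgType R).

Lemma star0 : star (0 : A) = 0.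
Proof. by apply: (@addrI _ (star (0 : A))); rewrite -starD !addr0. Qed.

Lemma star1 : star (1 : A) = 1.
Proof. by have := starM (star (1 : A)) 1; rewrite mulr1 starK mulr1. Qed.

Lemma star_sum (I : Type) (r : seq I) (P : pred I) (F : I -> A) :
  star (\sum_(i <- r | P i) F i) = \sum_(i <- r | P i) star (F i).
Proof. exact: (big_morph _ (@starD R A) star0). Qed.

Definition mxstar m n (v : 'M[A]_(m, n)) : 'M[A]_(n, m) :=
  \matrix_(i, j) star (v j i).

Lemma mxstarK m n (v : 'M[A]_(m, n)) : mxstar (mxstar v) = v.
Proof. by apply/matrixP => i j; rewrite !mxE starK. Qed.

Lemma mxstar0 m n : mxstar (0 : 'M[A]_(m, n)) = 0.
Proof. by apply/matrixP => i j; rewrite !mxE star0. Qed.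

Lemma mxstarM m n k (v : 'M[A]_(m, n)) (w : 'M[A]_(n, k)) :
  mxstar (v *m w) = mxstar w *m mxstar v.
Proof.
apply/matrixP => i j; rewrite !mxE star_sum.
by apply: eq_bigr => l _; rewrite !mxE starM.
Qed.

Lemma mxstar_block m1 m2 n1 n2 (a : 'M[A]_(m1, n1)) (b : 'M[A]_(m1, n2))
    (c : 'M[A]_(m2, n1)) (d : 'M[A]_(m2, n2)) :
  mxstar (block_mx a b c d) =
  block_mx (mxstar a) (mxstar c) (mxstar b) (mxstar d).
Proof.
apply/matrixP => i j; rewrite mxE -(fintype.splitK i) -(fintype.splitK j).
case: (fintype.split i) => i'; case: (fintype.split j) => j' /=;
  by rewrite ?(block_mxEul, block_mxEur, block_mxEdl, block_mxEdr) mxE.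
Qed.

Lemma mxstar_map (alpha : starAut A) m n (v : 'M[A]_(m, n)) :
  mxstar (map_mx alpha v) = map_mx alpha (mxstar v).
Proof. by apply/matrixP => i j; rewrite !mxE starAut_star. Qed.

Definition mx_projection n (p : 'M[A]_n) := mxstar p = p /\ p *m p = p.

Definition mx_mvn m n (p : 'M[A]_m) (q : 'M[A]_n) :=
  exists v : 'M[A]_(n, m), mxstar v *m v = p /\ v *m mxstar v = q.

Definition dsum_mx m n (p : 'M[A]_m) (q : 'M[A]_n) : 'M[A]_(m + n) :=
  block_mx p 0 0 q.

Lemma mx_mvn_refl n (p : 'M[A]_n) : mx_projection p -> mx_mvn p p.
Proof. by case=> sp pp; exists p; rewrite sp. Qed.

Lemma mx_mvn_sym m n (p : 'M[A]_m) (q : 'M[A]_n) : mx_mvn p q -> mx_mvn q p.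
Proof. by case=> v [vp vq]; exists (mxstar v); rewrite mxstarK. Qed.

Lemma mx_mvn_trans m n k (p : 'M[A]_m) (q : 'M[A]_n) (r : 'M[A]_k) :
  mx_projection p -> mx_projection r ->
  mx_mvn p q -> mx_mvn q r -> mx_mvn p r.
Proof.
move=> [_ pp] [_ rr] [v [vp vq]] [w [wq wr]]; exists (w *m v).
rewrite mxstarM; split.
  rewrite mulmxA -[_ *m mxstar w *m w]mulmxA wq -vq.
  by rewrite mulmxA vp -mulmxA vp.
rewrite mulmxA -[w *m v *m _]mulmxA vq -wq.
by rewrite mulmxA wr -mulmxA wr.
Qed.

Lemma dsum_projection m n (p : 'M[A]_m) (q : 'M[A]_n) :
  mx_projection p -> mx_projection q -> mx_projection (dsum_mx p q).
Proof.
move=> [sp pp] [sq qq]; split.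
  by rewrite mxstar_block sp sq !mxstar0.
by rewrite mulmx_block !(mulmx0, mul0mx) !(addr0, add0r) pp qq.
Qed.

Lemma dsum_mvn m n m' n' (p : 'M[A]_m) (q : 'M[A]_n)
    (p' : 'M[A]_m') (q' : 'M[A]_n') :
  mx_mvn p p' -> mx_mvn q q' -> mx_mvn (dsum_mx p q) (dsum_mx p' q').
Proof.
move=> [v [vp vp']] [w [wq wq']]; exists (block_mx v 0 0 w).
rewrite mxstar_block !mxstar0 !mulmx_block !(mulmx0, mul0mx).
by rewrite !(addr0, add0r) vp vp' wq wq'.
Qed.

Lemma dsum_mvnC m n (p : 'M[A]_m) (q : 'M[A]_n) :
  mx_projection p -> mx_projection q ->
  mx_mvn (dsum_mx p q) (dsum_mx q p).
Proof.
move=> [sp pp] [sq qq]; exists (block_mx 0 q p 0).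
rewrite mxstar_block !mxstar0 !mulmx_block !(mulmx0, mul0mx).
by rewrite !(addr0, add0r) sp sq pp qq.
Qed.

Lemma cast_mvn m n (e : m = n) (p : 'M[A]_m) :
  mx_projection p -> mx_mvn p (castmx (e, e) p).
Proof. by case: n / e => hp; rewrite castmx_id; apply: mx_mvn_refl. Qed.

Lemma dsum_mvnA m n k (p : 'M[A]_m) (q : 'M[A]_n) (r : 'M[A]_k) :
  mx_projection p -> mx_projection q -> mx_projection r ->
  mx_mvn (dsum_mx p (dsum_mx q r)) (dsum_mx (dsum_mx p q) r).
Proof.
move=> hp hq hr; apply: mx_mvn_sym.
have -> : dsum_mx p (dsum_mx q r) =
  castmx (esym (addnA m n k), esym (addnA m n k)) (dsum_mx (dsum_mx p q) r).
  have := @block_mxAx A m n k m n k p 0 0 0 q 0 0 0 r.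
  by rewrite !row_mx0 !col_mx0.
by apply: cast_mvn; do !apply: dsum_projection.
Qed.

Lemma dsum0_mvn n (p : 'M[A]_n) :
  mx_projection p -> mx_mvn (dsum_mx (0 : 'M[A]_0) p) p.
Proof.
move=> [sp pp]; exists (row_mx 0 p).
have -> : mxstar (row_mx (0 : 'M[A]_(n, 0)) p) = col_mx 0 p.
  apply/matrixP => i j; rewrite mxE -(fintype.splitK i).
  case: (fintype.split i) => [[]//|i'] /=.
  by rewrite row_mxEr col_mxEd -[in RHS]sp mxE.
by rewrite mul_row_col mul_col_row !mul0mx !mulmx0 add0r pp.
Qed.

Lemma map_projection (alpha : starAut A) n (p : 'M[A]_n) :
  mx_projection p -> mx_projection (map_mx alpha p).
Proof. by move=> [sp pp]; split; rewrite ?mxstar_map -?map_mxM ?sp ?pp. Qed.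

Lemma map_mvn (alpha : starAut A) m n (p : 'M[A]_m) (q : 'M[A]_n) :
  mx_mvn p q -> mx_mvn (map_mx alpha p) (map_mx alpha q).
Proof.
by move=> [v [vp vq]]; exists (map_mx alpha v); rewrite mxstar_map -!map_mxM vp vq.
Qed.

Lemma map_dsum (alpha : starAut A) m n (p : 'M[A]_m) (q : 'M[A]_n) :
  map_mx alpha (dsum_mx p q) = dsum_mx (map_mx alpha p) (map_mx alpha q).
Proof. by rewrite /dsum_mx map_block_mx !map_mx0. Qed.

Lemma mx_projection0 n : mx_projection (0 : 'M[A]_n).
Proof. by split; rewrite ?mxstar0 ?mulmx0. Qed.

Lemma mx_projection1 n : mx_projection (1%:M : 'M[A]_n).
Proof.
split; rewrite ?mulmx1 //; apply/matrixP => i j; rewrite !mxE eq_sym.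
by case: eqP => _ /=; rewrite ?star1 ?star0.
Qed.

End StarMatrices.

(* The abelian monoid V(A) of Murray-von Neumann classes of projections in
   matrix algebras over A, under direct sum. *)
Section MvNMonoid.
Variables (R : realType) (A : cstarAlgType R).

Record mxproj := MxProj {
  mxproj_size : nat ;
  mxproj_val : 'M[A]_mxproj_size ;
  mxprojP : mx_projection mxproj_val
}.

HB.instance Definition _ := gen_eqMixin mxproj.
HB.instance Definition _ := gen_choiceMixin mxproj.

Definition mxproj_equiv (p q : mxproj) : bool :=
  `[< mx_mvn (mxproj_val p) (mxproj_val q) >].

Lemma mxproj_equivP : equiv_class_of mxproj_equiv.
Proof.
split.
- by move=> p; apply/asboolP/mx_mvn_refl/mxprojP.
- by move=> p q; apply/asboolP/asboolP => /mx_mvn_sym.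
- move=> q p r /asboolP pq /asboolP qr; apply/asboolP.
  by apply: mx_mvn_trans pq qr; apply: mxprojP.
Qed.

Canonical mxproj_equiv_rel := EquivRelPack mxproj_equivP.

Definition mvnV := {eq_quot mxproj_equiv}.

HB.instance Definition _ := Choice.on mvnV.
HB.instance Definition _ : EqQuotient _ mxproj_equiv mvnV := EqQuotient.on mvnV.

Definition mvnV_class n (p : 'M[A]_n) (hp : mx_projection p) : mvnV :=
  \pi_mvnV (MxProj hp).

Lemma mvnV_classP m n (p : 'M[A]_m) (hp : mx_projection p)
    (q : 'M[A]_n) (hq : mx_projection q) :
  mvnV_class hp = mvnV_class hq <-> mx_mvn p q.
Proof.
by split=> [/eqmodP/asboolP|h]; [|apply/eqmodP/asboolP].
Qed.

Lemma mvnV_ind (P : mvnV -> Prop) :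
  (forall n (p : 'M[A]_n) (hp : mx_projection p), P (mvnV_class hp)) ->
  forall x, P x.
Proof. by move=> h x; rewrite -[x]reprK; case: (repr x). Qed.

Definition mvnV_zero : mvnV := mvnV_class (@mx_projection0 R A 0).

Definition mvnV_add (x y : mvnV) : mvnV :=
  mvnV_class (dsum_projection (mxprojP (repr x)) (mxprojP (repr y))).

Lemma mvnV_repr n (p : 'M[A]_n) (hp : mx_projection p) :
  mx_mvn (mxproj_val (repr (mvnV_class hp))) p.
Proof.
apply/(mvnV_classP (mxprojP (repr (mvnV_class hp))) hp).
by rewrite /mvnV_class; case: (repr _) (reprK (\pi_mvnV (MxProj hp))).
Qed.

Lemma mvnV_addE m n (p : 'M[A]_m) (hp : mx_projection p)
    (q : 'M[A]_n) (hq : mx_projection q) :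
  mvnV_add (mvnV_class hp) (mvnV_class hq) =
  mvnV_class (dsum_projection hp hq).
Proof. by apply/mvnV_classP; apply: dsum_mvn; apply: mvnV_repr. Qed.

Lemma mvnV_addA : associative mvnV_add.
Proof.
elim/mvnV_ind => m p hp; elim/mvnV_ind => n q hq; elim/mvnV_ind => k r hr.
by rewrite !mvnV_addE; apply/mvnV_classP; apply: dsum_mvnA.
Qed.

Lemma mvnV_addC : commutative mvnV_add.
Proof.
elim/mvnV_ind => m p hp; elim/mvnV_ind => n q hq.
by rewrite !mvnV_addE; apply/mvnV_classP; apply: dsum_mvnC.
Qed.

Lemma mvnV_add0 : left_id mvnV_zero mvnV_add.
Proof.
elim/mvnV_ind => m p hp; rewrite mvnV_addE; apply/mvnV_classP.
exact: dsum0_mvn.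
Qed.

HB.instance Definition _ :=
  GRing.isNmodule.Build mvnV mvnV_addA mvnV_addC mvnV_add0.

Lemma mvnV_classD m n (p : 'M[A]_m) (hp : mx_projection p)
    (q : 'M[A]_n) (hq : mx_projection q) :
  mvnV_class hp + mvnV_class hq = mvnV_class (dsum_projection hp hq).
Proof. exact: mvnV_addE. Qed.

Definition mvnV_map (alpha : starAut A) (x : mvnV) : mvnV :=
  mvnV_class (map_projection alpha (mxprojP (repr x))).

Lemma mvnV_mapE (alpha : starAut A) n (p : 'M[A]_n) (hp : mx_projection p) :
  mvnV_map alpha (mvnV_class hp) = mvnV_class (map_projection alpha hp).
Proof. by apply/mvnV_classP; apply: map_mvn; apply: mvnV_repr. Qed.

Lemma mvnV_map_is_nmod_morphism (alpha : starAut A) :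
  nmod_morphism (mvnV_map alpha).
Proof.
split.
  rewrite mvnV_mapE; apply/mvnV_classP; rewrite map_mx0.
  exact/mx_mvn_refl/mx_projection0.
elim/mvnV_ind => m p hp; elim/mvnV_ind => n q hq.
rewrite mvnV_classD !mvnV_mapE mvnV_classD; apply/mvnV_classP; rewrite map_dsum.
by apply: mx_mvn_refl; apply: dsum_projection; apply: map_projection.
Qed.

HB.instance Definition _ (alpha : starAut A) :=
  GRing.isNmodMorphism.Build mvnV mvnV (mvnV_map alpha)
    (mvnV_map_is_nmod_morphism alpha).

End MvNMonoid.

(* The Grothendieck group of an abelian monoid: [(a, b)] stands for [a - b]. *)
Section Grothendieck.
Variable M : nmodType.

Definition groth_equiv (u v : M * M) : bool :=
  `[< exists c : M, u.1 + v.2 + c = v.1 + u.2 + c >].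

Lemma groth_equivP : equiv_class_of groth_equiv.
Proof.
split.
- by move=> u; apply/asboolP; exists 0.
- by move=> u v; apply/asboolP/asboolP => -[c hc]; exists c.
- move=> v u w /asboolP[c hc] /asboolP[d hd]; apply/asboolP.
  exists (v.1 + v.2 + c + d).
  have -> : u.1 + w.2 + (v.1 + v.2 + c + d) = (u.1 + v.2 + c) + (v.1 + w.2 + d).
    by rewrite !addrA (AC 6 (1*4*5*3*2*6)).
  by rewrite hc hd !addrA (AC 6 (4*2*1*5*3*6)).
Qed.

Canonical groth_equiv_rel := EquivRelPack groth_equivP.

Definition groth := {eq_quot groth_equiv}.

HB.instance Definition _ := Choice.on groth.
HB.instance Definition _ : EqQuotient _ groth_equiv groth := EqQuotient.on groth.

Definition groth_diff (a b : M) : groth := \pi_groth (a, b).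

Lemma groth_diffP a b a' b' :
  groth_diff a b = groth_diff a' b' <-> exists c, a + b' + c = a' + b + c.
Proof. by split=> [/eqmodP/asboolP|h]; [|apply/eqmodP/asboolP]. Qed.

Lemma groth_ind (P : groth -> Prop) :
  (forall a b, P (groth_diff a b)) -> forall x, P x.
Proof. by move=> h x; rewrite -[x]reprK; case: (repr x). Qed.

Lemma groth_repr a b : exists c,
  (repr (groth_diff a b)).1 + b + c = a + (repr (groth_diff a b)).2 + c.
Proof.
by apply/groth_diffP; rewrite /groth_diff; case: (repr _) (reprK (\pi_groth (a, b))).
Qed.

Definition groth_zero : groth := groth_diff 0 0.

Definition groth_opp (x : groth) : groth := groth_diff (repr x).2 (repr x).1.

Definition groth_add (x y : groth) : groth :=
  groth_diff ((repr x).1 + (repr y).1) ((repr x).2 + (repr y).2).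

Lemma groth_oppE a b : groth_opp (groth_diff a b) = groth_diff b a.
Proof.
apply/groth_diffP; have [c hc] := groth_repr a b; exists c.
by rewrite [_ + a]addrC -hc [b + _]addrC.
Qed.

Lemma groth_addE a b a' b' :
  groth_add (groth_diff a b) (groth_diff a' b') = groth_diff (a + a') (b + b').
Proof.
apply/groth_diffP; have [c hc] := groth_repr a b.
have [d hd] := groth_repr a' b'; exists (c + d).
rewrite [in LHS](addrACA _ _ b) [in LHS](addrACA _ _ c) hc hd.
by rewrite [in RHS](addrACA a) [in RHS](addrACA _ _ c).
Qed.

Lemma groth_addA : associative groth_add.
Proof.
elim/groth_ind => a b; elim/groth_ind => a' b'; elim/groth_ind => a'' b''.
by rewrite !groth_addE !addrA.
Qed.

Lemma groth_addC : commutative groth_add.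
Proof.
elim/groth_ind => a b; elim/groth_ind => a' b'.
by rewrite !groth_addE [a + _]addrC [b + _]addrC.
Qed.

Lemma groth_add0 : left_id groth_zero groth_add.
Proof. by elim/groth_ind => a b; rewrite groth_addE !add0r. Qed.

Lemma groth_addN : left_inverse groth_zero groth_opp groth_add.
Proof.
elim/groth_ind => a b; rewrite groth_oppE groth_addE; apply/groth_diffP.
by exists 0; rewrite !addr0 add0r addrC.
Qed.

HB.instance Definition _ :=
  GRing.isZmodule.Build groth groth_addA groth_addC groth_add0 groth_addN.

Lemma groth_diffD a b a' b' :
  groth_diff a b + groth_diff a' b' = groth_diff (a + a') (b + b').
Proof. exact: groth_addE. Qed.

Lemma groth_diffN a b : - groth_diff a b = groth_diff b a.
Proof. exact: groth_oppE. Qed.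

Definition groth_of (a : M) : groth := groth_diff a 0.

Lemma groth_diffE a b : groth_diff a b = groth_of a - groth_of b.
Proof. by rewrite /groth_of groth_diffN groth_diffD addr0 add0r. Qed.

End Grothendieck.

Section GrothendieckMap.
Variables (M N : nmodType) (f : {additive M -> N}).

Definition groth_map (x : groth M) : groth N :=
  groth_diff (f (repr x).1) (f (repr x).2).

Lemma groth_mapE a b : groth_map (groth_diff a b) = groth_diff (f a) (f b).
Proof.
apply/groth_diffP; have [c hc] := groth_repr a b; exists (f c).
by rewrite -!raddfD hc.
Qed.

Lemma groth_map_is_zmod_morphism : zmod_morphism groth_map.
Proof.
elim/groth_ind => a b; elim/groth_ind => a' b'.
by rewrite groth_diffN groth_diffD !groth_mapE groth_diffN groth_diffD !raddfD.
Qed.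

HB.instance Definition _ :=
  GRing.isZmodMorphism.Build (groth M) (groth N) groth_map
    groth_map_is_zmod_morphism.

End GrothendieckMap.

Section K0.
Variables (R : realType) (A : cstarAlgType R).

(* As A is unital, K_0(A) is the Grothendieck group of V(A). *)
Definition K0 := groth (mvnV A).

HB.instance Definition _ := GRing.Zmodule.on K0.

Definition K0_class n (p : 'M[A]_n) (hp : mx_projection p) : K0 :=
  groth_of (mvnV_class hp).

Definition K0_unit : K0 := K0_class (@mx_projection1 R A 1).

Definition K0_le (eta zeta : K0) :=
  exists (n : nat) (p : 'M[A]_n) (hp : mx_projection p),
    zeta - eta = K0_class hp.

Definition infinitesimal (eta : K0) :=
  forall m n : nat, (0 < m)%N ->
    K0_le (- (K0_unit *+ m)) (eta *+ n) /\ K0_le (eta *+ n) (K0_unit *+ m).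

Definition K0_map (alpha : starAut A) : K0 -> K0 := groth_map (mvnV_map alpha).

HB.instance Definition _ (alpha : starAut A) :=
  GRing.Additive.on (K0_map alpha).

Lemma K0_map_class (alpha : starAut A) n (p : 'M[A]_n)
    (hp : mx_projection p) :
  K0_map alpha (K0_class hp) = K0_class (map_projection alpha hp).
Proof.
rewrite /K0_class -mvnV_mapE /groth_of -[in RHS](raddf0 (mvnV_map alpha)).
exact: groth_mapE.
Qed.

Lemma K0_diff (eta : K0) :
  exists m n (p : 'M[A]_m) (hp : mx_projection p)
         (q : 'M[A]_n) (hq : mx_projection q), eta = K0_class hp - K0_class hq.
Proof.
elim/groth_ind: eta => a b; elim/mvnV_ind: a => m p hp.
elim/mvnV_ind: b => n q hq.
by exists m, n, p, hp, q, hq; apply: groth_diffE.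
Qed.

End K0.

(* Main.v *)
Require Import Defs.
From mathcomp Require Import all_boot all_order all_algebra.
From mathcomp Require Import complex.
From mathcomp Require Import all_classical all_reals all_analysis.
From mathcomp Require Import ring lra.

Set Implicit Arguments.
Unset Strict Implicit.
Unset Printing Implicit Defensive.

Import Order.TTheory GRing.Theory Num.Theory.
Import numFieldNormedType.Exports.
Local Open Scope classical_set_scope.
Local Open Scope complex_scope.
Local Open Scope ring_scope.

(** As alpha fixes the classes of the identity matrices and
    [p] - [q] = [p (+) (1 - q)] - [1_n], it is enough to treat eta = [e] for a
    projection e of M_k(A).  Apply approximate innerness to the entries of e.
    The diagonal matrix P_i with entries p_i almost commutes with e, so that e
    is equivalent to f_i + g_i, where f_i <= P_i is a projection close to
    P_i e P_i and g_i <= 1 - P_i ([split_projection]).  Conjugation by v takes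
    P_1 e P_1 almost to alpha(P_2 e P_2), hence f_1 is equivalent to alpha(f_2)
    ([conjugate_projections]), and these terms cancel:
    alpha_*[e] - [e] = alpha_*[g_2] - [g_1].  Finally [g_i] <= k [1 - p_i], and
    1 - p_i is equivalent to a projection q_i of the hereditary subalgebra of x
    ([displacement_bounds]).

    It remains to choose x such that m [q] <= [1] for every projection q of the
    hereditary subalgebra of x, where m is given ([small_positive]).  If the
    hereditary subalgebra of some x contains no projection but 0, this x will
    do.  Otherwise all of them contain nonzero projections, and x can be a
    projection s with 2 ^ m [s] <= [1].  Such an s is found by halving: a
    projection whose only subprojections are trivial has a one-dimensional
    corner, and by simplicity A would be finite dimensional, so every projection
    splits ([proj_splits]); by simplicity again the two pieces contain equivalent
    nonzero subprojections ([compare_projections], [proj_halving]).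

    The analysis all rests on one iteration, which computes a square root of
    1 - x for |x| <= 1 in any complete normed *-ring ([sqrt_exists]).  Applied
    to M_k(A) with the sum of the norms of the entries, which is not a C*-norm,
    it gives the perturbation results on projections.  Applied to A it replaces
    the functional calculus: an element is called positive here if it is the
    square of a self-adjoint element, which for self-adjoint a amounts to
    |t - a| <= t for some real t ([psd_norm], [psd_of_norm]).  From this follow
    the contractivity of alpha, the positivity of star y * y
    ([psd_star_mul]) and the fact that the norm of a positive element belongs to
    its spectrum ([norm_in_spectrum]). *)

(** * Identities in noncommutative rings *)

Section NoncommutativeIdentities.

Inductive ncterm :=
  NcVar of nat | NcZero | NcOne | NcAdd of ncterm & ncterm
| NcOpp of ncterm | NcMul of ncterm & ncterm.

(** A signed monomial; the sign [true] stands for -1. *)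
Definition ncword := (bool * seq nat)%type.

Fixpoint ncwords (e : ncterm) : seq ncword :=
  match e with
  | NcVar i => [:: (false, [:: i])]
  | NcZero => [::]
  | NcOne => [:: (false, [::])]
  | NcAdd e1 e2 => ncwords e1 ++ ncwords e2
  | NcOpp e1 => [seq (~~ w.1, w.2) | w <- ncwords e1]
  | NcMul e1 e2 =>
      [seq (w1.1 (+) w2.1, w1.2 ++ w2.2) | w1 <- ncwords e1, w2 <- ncwords e2]
  end.

(** Cancels each monomial against an opposite one further on; the fuel is the
    length of the list. *)
Fixpoint nccancel (fuel : nat) (l : seq ncword) : bool :=
  match fuel, l with
  | _, [::] => true
  | k.+1, w :: l' =>
      let w' := (~~ w.1, w.2) in (w' \in l') && nccancel k (rem w' l')
  | 0, _ :: _ => false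
  end.

Variables (B : pzRingType) (env : seq B).

Fixpoint nceval (e : ncterm) : B :=
  match e with
  | NcVar i => nth 0 env i
  | NcZero => 0
  | NcOne => 1
  | NcAdd e1 e2 => nceval e1 + nceval e2
  | NcOpp e1 => - nceval e1
  | NcMul e1 e2 => nceval e1 * nceval e2
  end.

Definition ncword_val (w : ncword) : B :=
  (-1) ^+ w.1 * \prod_(i <- w.2) nth 0 env i.

Lemma ncword_valN b w : ncword_val (~~ b, w) = - ncword_val (b, w).
Proof. by rewrite /ncword_val /= signrN mulNr. Qed.

Lemma nceval_words e : nceval e = \sum_(w <- ncwords e) ncword_val w.
Proof.
elim: e => [i|||e1 IH1 e2 IH2|e1 IH1|e1 IH1 e2 IH2] /=.
- by rewrite big_seq1 /ncword_val /= mul1r big_seq1.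
- by rewrite big_nil.
- by rewrite big_seq1 /ncword_val /= mul1r big_nil.
- by rewrite IH1 IH2 big_cat.
- rewrite IH1 big_map -sumrN; apply: eq_bigr => -[b w] _.
  by rewrite ncword_valN.
rewrite IH1 IH2 big_allpairs_dep mulr_suml; apply: eq_bigr => -[b w] _.
rewrite mulr_sumr; apply: eq_bigr => -[b' w'] _.
rewrite /ncword_val /= big_cat signr_addb /= -!mulrA; congr (_ * _).
by rewrite !mulrA -(commr_sign (\prod_(i <- w) _)).
Qed.

Lemma nccancelP k l : nccancel k l -> \sum_(w <- l) ncword_val w = 0.
Proof.
elim: k l => [|k IH] [|[b w] l] //=; rewrite ?big_nil //.
case/andP=> hin /IH {IH} h.
by rewrite big_cons (big_rem _ hin) /= ncword_valN addrA subrr add0r h.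
Qed.

Lemma nc_eq (e1 e2 : ncterm) :
  (let l := ncwords (NcAdd e1 (NcOpp e2)) in nccancel (size l) l) ->
  nceval e1 = nceval e2.
Proof.
move=> /nccancelP h; apply/eqP; rewrite -subr_eq0; apply/eqP.
by rewrite -[LHS]/(nceval (NcAdd e1 (NcOpp e2))) nceval_words.
Qed.

End NoncommutativeIdentities.

Ltac nc_mem x l :=
  lazymatch l with
  | nil => constr:(false)
  | cons x _ => constr:(true)
  | cons _ ?l' => nc_mem x l'
  end.

Ltac nc_index x l :=
  lazymatch l with
  | cons x _ => constr:(0%N)
  | cons _ ?l' => let n := nc_index x l' in constr:(S n)
  end.

Ltac nc_atoms e l :=
  lazymatch e with
  | 0%R => l
  | 1%R => l
  | (?a + ?b)%R => let l1 := nc_atoms a l in nc_atoms b l1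
  | (?a * ?b)%R => let l1 := nc_atoms a l in nc_atoms b l1
  | (- ?a)%R => nc_atoms a l
  | ?x => let b := nc_mem x l in
          lazymatch b with true => l | false => constr:(cons x l) end
  end.

Ltac nc_reify e l :=
  lazymatch e with
  | 0%R => constr:(NcZero)
  | 1%R => constr:(NcOne)
  | (?a + ?b)%R =>
      let u := nc_reify a l in let v := nc_reify b l in constr:(NcAdd u v)
  | (?a * ?b)%R =>
      let u := nc_reify a l in let v := nc_reify b l in constr:(NcMul u v)
  | (- ?a)%R => let u := nc_reify a l in constr:(NcOpp u)
  | ?x => let n := nc_index x l in constr:(NcVar n)
  end.

(** Decides the identities that hold in every ring, commutative or not. *)
Ltac ncring :=
  lazymatch goal with
  | |- @eq ?T ?a ?b =>
      let l0 := nc_atoms a (@nil T) in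
      let l := nc_atoms b l0 in
      let u := nc_reify a l in let v := nc_reify b l in
      refine (@nc_eq _ l u v _); vm_compute; reflexivity
  end.

(** * Square roots in complete normed *-rings *)

(** The common ground of A and of its matrix algebras.  The C*-identity is left
    out, because the norm used on matrices does not satisfy it.  Division by two
    is the only part of the scalar action that square roots require.
    Completeness is stated for sequences with a bounded real majorant, the form
    in which the iterations below converge. *)
Record banachStar (R : realType) (B : pzRingType) := BanachStar {
  bnorm : B -> R ;
  bstar : B -> B ;
  bhalf : B ;
  ler_bnormD : forall x y, bnorm (x + y) <= bnorm x + bnorm y ;
  bnormN : forall x, bnorm (- x) = bnorm x ;
  bnorm0_eq0 : forall x, bnorm x = 0 -> x = 0 ;
  ler_bnormM : forall x y, bnorm (x * y) <= bnorm x * bnorm y ;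
  bstarD : forall x y, bstar (x + y) = bstar x + bstar y ;
  bstarM : forall x y, bstar (x * y) = bstar y * bstar x ;
  bstarK : involutive bstar ;
  bnorm_star : forall x, bnorm (bstar x) = bnorm x ;
  bhalf2 : bhalf + bhalf = 1 ;
  bhalfC : forall x, bhalf * x = x * bhalf ;
  ler_bnorm_half : forall x, bnorm (bhalf * x) <= bnorm x / 2 ;
  bcomplete : forall (u : nat -> B) (b : nat -> R) (c : R),
    (forall n, bnorm (u n.+1 - u n) <= b n.+1 - b n) ->
    (forall n, b n <= c) ->
    exists l, (fun n => bnorm (u n - l)) @ \oo --> (0 : R)
}.

Section SquareRoots.
Variables (R : realType) (B : pzRingType) (T : banachStar R B).
Implicit Types (x y z p q : B).

Local Notation N := (bnorm T).
Local Notation st := (bstar T).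
Local Notation h := (bhalf T).

Definition sproj p := st p = p /\ p * p = p.

Lemma bnorm_ge0 x : 0 <= N x.
Proof.
have := ler_bnormD T x (- x); have := ler_bnormD T 0 0.
rewrite bnormN subrr addr0; lra.
Qed.

Lemma bnorm0 : N 0 = 0.
Proof.
have := ler_bnorm_half T 0; have := bnorm_ge0 0; rewrite mulr0; lra.
Qed.

Lemma ler_bnormB x y : N (x - y) <= N x + N y.
Proof. by have := ler_bnormD T x (- y); rewrite bnormN. Qed.

Lemma bnormBC x y : N (x - y) = N (y - x).
Proof. by rewrite -bnormN opprB. Qed.

Lemma bstar0 : st 0 = 0.
Proof. by apply: (@addrI _ (st 0)); rewrite -bstarD !addr0. Qed.

Lemma bstarN x : st (- x) = - st x.
Proof. by apply: (@addrI _ (st x)); rewrite -bstarD !subrr bstar0. Qed.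

Lemma bstarB x y : st (x - y) = st x - st y.
Proof. by rewrite bstarD bstarN. Qed.

Lemma bstar1 : st 1 = 1.
Proof. by have := bstarM T (st 1) 1; rewrite mulr1 bstarK mulr1. Qed.

Lemma mulr_halfD x : h * x + h * x = x.
Proof. by rewrite -mulrDl bhalf2 mul1r. Qed.

Lemma addrr_inj x y : x + x = y + y -> x = y.
Proof.
by move=> e; rewrite -(mulr_halfD x) -mulrDr e mulrDr mulr_halfD.
Qed.

Lemma bstar_half : st h = h.
Proof.
by apply: addrr_inj; rewrite -bstarD bhalf2 bstar1.
Qed.

Lemma bnormM_le x y a b : N x <= a -> N y <= b -> N (x * y) <= a * b.
Proof.
by move=> xa yb; apply: le_trans (ler_bnormM T x y) _; apply: ler_pM => //; apply: bnorm_ge0.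
Qed.

Lemma bnorm_le_cvg0 z (v : nat -> R) :
  v @ \oo --> (0 : R) -> (forall n, N z <= v n) -> z = 0.
Proof.
move=> v0 zv; apply: (@bnorm0_eq0 _ _ T); apply/eqP; rewrite eq_le bnorm_ge0 andbT.
rewrite -(cvg_lim _ v0) //.
apply: limr_ge; first by apply/cvg_ex; exists 0.
by near=> n; apply: zv.
Unshelve. all: by end_near. Qed.

Lemma bnorm_lim_eq0 z (K : R) (u : nat -> B) l :
  (fun n => N (u n - l)) @ \oo --> (0 : R) ->
  (forall n, N z <= K * N (u n - l)) -> z = 0.
Proof.
move=> ul; apply: bnorm_le_cvg0.
by rewrite -(mulr0 K); apply: cvgMr.
Qed.

(** A fixed point y satisfies 2 y = x + y ^ 2, so 1 - y is a square root of
    1 - x. *)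
Fixpoint sqrt_iter x n : B :=
  if n is k.+1 then h * (x + sqrt_iter x k * sqrt_iter x k) else 0.

(** The iteration at x = 1 over the reals; it dominates every iteration with
    |x| <= 1, including the boundary case, where a geometric bound fails. *)
Fixpoint sqrt_major n : R :=
  if n is k.+1 then (1 + sqrt_major k ^+ 2) / 2 else 0.

Lemma sqrt_major_bound n : 0 <= sqrt_major n <= 1.
Proof.
elim: n => [|n /andP[h0 h1]] /=; first by rewrite lexx ler01.
nra.
Qed.

Lemma sqrt_iter_comm x z n : z * x = x * z -> z * sqrt_iter x n = sqrt_iter x n * z.
Proof.
move=> zx; elim: n => [|n IH] /=; first by rewrite mulr0 mul0r.
by rewrite mulrA -(bhalfC T z) -!mulrA mulrDr mulrDl zx mulrA IH -!mulrA IH.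
Qed.

Lemma sqrt_iter_norm x n : N x <= 1 -> N (sqrt_iter x n) <= sqrt_major n.
Proof.
move=> x1; elim: n => [|n IH] /=; first by rewrite bnorm0.
have := bnormM_le IH IH.
have := ler_bnormD T x (sqrt_iter x n * sqrt_iter x n).
have := ler_bnorm_half T (x + sqrt_iter x n * sqrt_iter x n).
rewrite expr2; lra.
Qed.

(** u' - v' = (u + v) (u - v) / 2 for commuting u and v, and the same identity
    holds for the majorant. *)
Lemma sqrt_iter_step x n : N x <= 1 ->
  N (sqrt_iter x n.+1 - sqrt_iter x n) <= sqrt_major n.+1 - sqrt_major n.
Proof.
move=> x1; elim: n => [|n IH].
  rewrite /= mul0r expr0n /= !addr0 !subr0.
  by have := ler_bnorm_half T x; lra.
set u := sqrt_iter x n.+1; set v := sqrt_iter x n in IH *.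
have uv : u * v = v * u.
  by apply: sqrt_iter_comm; rewrite sqrt_iter_comm.
have -> : sqrt_iter x n.+2 - u = h * ((u + v) * (u - v)).
  have e : (u + v) * (u - v) = (x + u * u) - (x + v * v) + (v * u - u * v).
    by ncring.
  by rewrite e uv subrr addr0 mulrBr.
have h1 := sqrt_iter_norm n x1; have h2 := sqrt_iter_norm n.+1 x1.
have h3 : N (u + v) <= sqrt_major n.+1 + sqrt_major n.
  by apply: le_trans (ler_bnormD _ _ _) _; apply: lerD.
have := bnormM_le h3 IH; have := ler_bnorm_half T ((u + v) * (u - v)).
rewrite [sqrt_major n.+2]/= -/(sqrt_major n.+1).
set a := sqrt_major n.+1.
have -> : a = (1 + sqrt_major n ^+ 2) / 2 by [].
nra.
Qed.

(** The iterates are polynomials in x with real coefficients and no constant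
    term; commutation with z, annihilation by z and self-adjointness therefore
    pass from x to the limit. *)
Lemma sqrt_exists x : N x <= 1 ->
  exists y, [/\ N y <= N x, (1 - y) * (1 - y) = 1 - x,
    forall z, z * x = x * z -> z * y = y * z,
    forall z, z * x = 0 -> z * y = 0 & st x = x -> st y = y].
Proof.
move=> x1.
have [n|n|y uy] := @bcomplete _ _ T (sqrt_iter x) sqrt_major 1.
- exact: sqrt_iter_step.
- by case/andP: (sqrt_major_bound n).
have y1 : N y <= 1.
  have lim1 : (fun n => 1 + N (sqrt_iter x n - y)) @ \oo --> (1 + 0 : R).
    by apply: cvgD => //; exact: cvg_cst.
  rewrite addr0 in lim1; rewrite -(cvg_lim _ lim1) //.
  apply: limr_ge; first by apply/cvg_ex; exists 1.
  near=> n.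
  have := ler_bnormB (sqrt_iter x n) (sqrt_iter x n - y).
  have -> : sqrt_iter x n - (sqrt_iter x n - y) = y by ncring.
  have := sqrt_iter_norm n x1; have /andP[_] := sqrt_major_bound n; lra.
have fixy : y = h * (x + y * y).
  apply/eqP; rewrite -subr_eq0; apply/eqP.
  pose v n := N (sqrt_iter x n - y).
  apply: (@bnorm_le_cvg0 _ (fun n => v n.+1 + v n)) => [|n].
    rewrite -(addr0 0); apply: cvgD => //.
    by have := uy; rewrite -cvg_shiftS.
  set u := sqrt_iter x n.
  have -> : y - h * (x + y * y) =
      (y - sqrt_iter x n.+1) + h * (u * (u - y) + (u - y) * y).
    by rewrite /= -/u; ncring.
  apply: le_trans (ler_bnormD _ _ _) _; rewrite bnormBC; apply: lerD => //.
  have := ler_bnorm_half T (u * (u - y) + (u - y) * y).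
  have := ler_bnormD T (u * (u - y)) ((u - y) * y).
  have := ler_bnormM T u (u - y); have := ler_bnormM T (u - y) y.
  have u1 : N u <= 1.
    by apply: le_trans (sqrt_iter_norm n x1) _; case/andP: (sqrt_major_bound n).
  have := bnorm_ge0 (u - y); rewrite /v -/u; nra.
have sq : (1 - y) * (1 - y) = 1 - x.
  have e : y + y = x + y * y by rewrite {1 2}fixy mulr_halfD.
  have -> : (1 - y) * (1 - y) = 1 - (y + y) + y * y by ncring.
  by rewrite e; ncring.
exists y; split => //.
- have := ler_bnorm_half T (x + y * y); rewrite -fixy.
  have := ler_bnormD T x (y * y); have := ler_bnormM T y y.
  have := bnorm_ge0 y; nra.
- move=> z zx; apply/eqP; rewrite -subr_eq0; apply/eqP.
  apply: (bnorm_lim_eq0 (K := N z + N z) uy) => n.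
  have := sqrt_iter_comm n zx; set u := sqrt_iter x n => zu.
  have -> : z * y - y * z = (u - y) * z - z * (u - y).
    by rewrite mulrBl mulrBr zu; ncring.
  apply: le_trans (ler_bnormB _ _) _.
  have := ler_bnormM T (u - y) z; have := ler_bnormM T z (u - y); lra.
- move=> z zx; apply: (bnorm_lim_eq0 (K := N z) uy) => n.
  have zu : z * sqrt_iter x n = 0.
    elim: n => [|n IH] /=; first by rewrite mulr0.
    by rewrite mulrA -(bhalfC T) -mulrA mulrDr zx add0r (mulrA z) IH mul0r mulr0.
  rewrite -[z * y]opprK -[- (z * y)]add0r -zu -mulrBr bnormN; exact: ler_bnormM.
move=> sx; apply/eqP; rewrite -subr_eq0; apply/eqP.
apply: (bnorm_lim_eq0 (K := 2) uy) => n.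
have su : st (sqrt_iter x n) = sqrt_iter x n.
  elim: n => [|n IH] /=; first by rewrite bstar0.
  by rewrite bstarM bstarD bstarM bstar_half sx IH bhalfC.
set u := sqrt_iter x n in su *.
have -> : st y - y = (u - y) - st (u - y) by rewrite bstarB su; ncring.
apply: le_trans (ler_bnormB _ _) _; rewrite bnorm_star; lra.
Unshelve. all: by end_near. Qed.

End SquareRoots.

(** * Inverse square roots and nearby projections *)

Section InverseRoots.
Variables (R : realType) (B : pzRingType) (T : banachStar R B).
Implicit Types (x y z p q : B).

Local Notation N := (bnorm T).
Local Notation st := (bstar T).
Local Notation h := (bhalf T).

Lemma neumann x : N x < 1 ->
  exists c : B, [/\ c * (1 - x) = 1, (1 - x) * c = 1
              & N c <= N 1 / (1 - N x)].
Proof.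
move=> x1; have x0 := bnorm_ge0 T x.
pose u := fix u n := if n is k.+1 then 1 + x * u k else 0.
have uS n : u n.+1 = 1 + x * u n by [].
pose b n := N 1 * ((1 - N x ^+ n) / (1 - N x)).
have ux n : x * u n = u n * x.
  by elim: n => [|n IH]; rewrite ?uS ?mulr0 ?mul0r // mulrDr mulrDl -mulrA -IH; ncring.
have [n|n|c uc] := @bcomplete _ _ T u b (N 1 / (1 - N x)).
- have -> : b n.+1 - b n = N 1 * N x ^+ n by rewrite /b exprS; field; lra.
  elim: n => [|n IH]; first by rewrite /= mulr0 addr0 subr0 expr0 mulr1.
  have -> : u n.+2 - u n.+1 = x * (u n.+1 - u n) by rewrite !uS; ncring.
  rewrite exprS mulrCA; exact: bnormM_le.
- rewrite /b ler_wpM2l ?bnorm_ge0 // ler_pdivrMr; last lra.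
  rewrite mulVf; last lra.
  by have := exprn_ge0 n x0; lra.
have fixc : c = 1 + x * c.
  apply/eqP; rewrite -subr_eq0; apply/eqP.
  pose v n := N (u n - c).
  apply: (@bnorm_le_cvg0 _ _ T _ (fun n => v n.+1 + N x * v n)) => [|n].
    rewrite -[X in _ --> X]addr0; apply: cvgD.
      by have := uc; rewrite -cvg_shiftS.
    by rewrite -(mulr0 (N x)); apply: cvgMr.
  have -> : c - (1 + x * c) = (c - u n.+1) + x * (u n - c) by rewrite uS; ncring.
  apply: le_trans (ler_bnormD _ _ _) _; rewrite bnormBC; apply: lerD => //.
  exact: ler_bnormM.
have cx : c * x = x * c.
  apply/eqP; rewrite -subr_eq0; apply/eqP.
  apply: (bnorm_lim_eq0 (K := N x + N x) uc) => n.
  have -> : c * x - x * c = x * (u n - c) - (u n - c) * x.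
    by rewrite mulrBl mulrBr ux; ncring.
  apply: le_trans (ler_bnormB _ _ _) _.
  have := ler_bnormM T (u n - c) x; have := ler_bnormM T x (u n - c); lra.
have e1 : (1 - x) * c = 1 by rewrite mulrBl mul1r {1}fixc; ncring.
have e2 : c * (1 - x) = 1 by rewrite -[RHS]e1 mulrBr mulrBl cx; ncring.
exists c; split => //.
rewrite ler_pdivlMr; last lra.
have := ler_bnormD T 1 (x * c); rewrite -fixc; have := ler_bnormM T x c; lra.
Qed.

(** The inverse of the square root 1 - y of 1 - x. *)
Lemma inv_sqrt x : N x < 1 -> st x = x ->
  exists c : B, [/\ st c = c, c * c * (1 - x) = 1,
    forall z, z * x = x * z -> z * c = c * z,
    forall z, z * x = 0 -> z * c = z
    & N (c - 1) <= N x * (N 1 / (1 - N x))].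
Proof.
move=> x1 sx; have [y [yx sq comm ann sy]] := sqrt_exists (ltW x1).
have {}sy := sy sx.
have [c [c1 c2 cn]] : exists c : B, [/\ c * (1 - y) = 1, (1 - y) * c = 1
              & N c <= N 1 / (1 - N y)] by apply: neumann; apply: le_lt_trans yx x1.
have inv z : (1 - y) * z = z * (1 - y) -> c * z = z * c.
  move=> e; rewrite -[LHS]mulr1 -c2 mulrA -(mulrA c) -e !mulrA c1 mul1r //.
have cinj z z' : (1 - y) * z = (1 - y) * z' -> z = z'.
  by move=> e; rewrite -[z]mul1r -c1 -mulrA e mulrA c1 mul1r.
exists c; split.
- apply: cinj; rewrite c2; have := congr1 st c1.
  by rewrite bstarM bstarB bstar1 sy.
- by rewrite -sq mulrA -(mulrA c) c1 mulr1 c1.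
- by move=> z /comm zy; rewrite -inv // mulrBl mulrBr zy; ncring.
- move=> z /ann zy.
  have e : z = z * (1 - y) by rewrite mulrBr zy; ncring.
  by rewrite {1}e -mulrA c2 mulr1.
have -> : c - 1 = y * c by rewrite -c2; ncring.
apply: (bnormM_le yx); apply: le_trans cn _.
apply: ler_wpM2l; first exact: bnorm_ge0.
rewrite lef_pV2 ?posrE. all: lra.
Qed.

(** With s = 2 a - 1 the defect of a is measured by s ^ 2 = 1 - 4 (a - a ^ 2).
    Dividing s by the square root of the right-hand side gives a symmetry, and
    (1 + symmetry) / 2 is the projection. *)
Lemma near_projection a : st a = a -> N (a - a * a) <= 1 / 8 ->
  exists p : B, [/\ sproj T p, forall z, z * a = 0 -> z * p = 0
    & N (p - a) <= 4 * (2 * N a + N 1) * N 1 * N (a - a * a)].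
Proof.
move=> sa ta.
pose t := a - a * a; pose s := a + a - 1.
pose x := t + t + t + t.
have nx : N x <= 4 * N t.
  have := ler_bnormD T t t; have := ler_bnormD T (t + t) t.
  have := ler_bnormD T (t + t + t) t; rewrite -/x; lra.
have x2 : N x <= 1 / 2 by move: ta; rewrite -/t; lra.
have x1 : N x < 1 by lra.
have st' : st t = t by rewrite /t bstarB bstarM sa.
have sx : st x = x by rewrite /x 3!bstarD st'.
have [c [sc cc comm ann cn]] := inv_sqrt x1 sx.
have ss : s * s = 1 - x by rewrite /s /x /t; ncring.
have sxs : s * x = x * s by rewrite /s /x /t; ncring.
have scs := comm _ sxs.
(* The symmetry s / |s|. *)
have e1 : (s * c) * (s * c) = 1.
  have xc : x * c = c * x by apply: comm.
  have x2c : x * (c * c) = c * c * x by rewrite mulrA xc -mulrA xc mulrA.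
  rewrite -[RHS]cc mulrBr -x2c -(mulrA s) (mulrA c) -scs -(mulrA s) mulrA ss.
  by ncring.
have sts : st s = s by rewrite /s bstarB bstarD sa bstar1.
exists (h * (1 + s * c)); split.
- split.
    by rewrite bstarM bstarD bstar1 bstarM sc sts -scs bstar_half bhalfC.
  rewrite -(mulrA h); congr (h * _).
  rewrite mulrA -(bhalfC T) -mulrA -[RHS](mulr_halfD T) -mulrDr; congr (h * _).
  have -> : (1 + s * c) * (1 + s * c) = 1 + s * c + s * c + (s * c) * (s * c).
    by ncring.
  by rewrite e1; ncring.
- move=> z za.
  have zt : z * x = 0 by rewrite /x /t !mulrDr mulrN mulrA za mul0r; ncring.
  have zs : z * s = - z by rewrite /s mulrBr mulrDr za; ncring.
  by rewrite mulrA -(bhalfC T) -mulrA mulrDr mulrA zs mulNr (ann _ zt) mulr1 subrr mulr0.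
have -> : h * (1 + s * c) - a = h * (s * (c - 1)).
  apply: (addrr_inj T); rewrite mulr_halfD.
  have -> : h * (1 + s * c) - a + (h * (1 + s * c) - a) =
    (h * (1 + s * c) + h * (1 + s * c)) - (a + a) by ncring.
  by rewrite mulr_halfD /s; ncring.
apply: le_trans (ler_bnorm_half T (s * (c - 1))) _.
have n1 := bnorm_ge0 T 1; have nt := bnorm_ge0 T t; have na := bnorm_ge0 T a.
have ns : N s <= 2 * N a + N 1.
  have := ler_bnormB T (a + a) 1; have := ler_bnormD T a a; rewrite -/s; lra.
have nc : N (c - 1) <= 8 * N t * N 1.
  apply: le_trans cn _.
  have e : N 1 / (1 - N x) <= 2 * N 1.
    by rewrite ler_pdivrMr; nra.
  have nx0 := bnorm_ge0 T x; nra.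
have := bnormM_le ns nc.
rewrite -/t; set L := N (s * (c - 1)) => hL.
have -> : 4 * (2 * N a + N 1) * N 1 * N t = (2 * N a + N 1) * (8 * N t * N 1) / 2 by field.
lra.
Qed.

End InverseRoots.

(** * Equivalence of nearby projections *)

Section EquivalentProjections.
Variables (R : realType) (B : pzRingType) (T : banachStar R B).
Implicit Types (x y z p q : B).

Local Notation N := (bnorm T).
Local Notation st := (bstar T).

(** Polar decomposition: star w * w is invertible in the corner of p, and c is
    its inverse square root there. *)
Lemma polar_left w p : sproj T p -> w * p = w -> N (p - st w * w) < 1 ->
  exists c : B, [/\ st c = c, st (w * c) * (w * c) = p
                  & st w * w * (c * c) = p].
Proof.
move=> [sp pp] wp x1; set x := p - st w * w in x1.
have pw : p * st w = st w by rewrite -{1}sp -bstarM wp.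
have px : p * x = x by rewrite /x mulrBr pp mulrA pw.
have xp : x * p = x by rewrite /x mulrBl pp -mulrA wp.
have sx : st x = x by rewrite /x bstarB bstarM bstarK sp.
have [c [sc cc comm _ _]] := inv_sqrt x1 sx.
have pc : p * c = c * p by apply: comm; rewrite px xp.
have xc : x * c = c * x by apply: comm.
have W : st w * w = p * (1 - x) by rewrite mulrBr px /x; ncring.
have xcc : (1 - x) * (c * c) = 1.
  rewrite -[RHS]cc mulrBr mulrBl (mulrA x) xc -(mulrA c x) xc; ncring.
exists c; split => //; last by rewrite W -mulrA xcc mulr1.
rewrite bstarM sc -mulrA (mulrA (st w)) W -(mulrA p) (mulrA c) -pc -mulrA.
have -> : (1 - x) * c = c * (1 - x) by rewrite mulrBl mulrBr xc; ncring.
by rewrite (mulrA c) cc mulr1.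
Qed.

(** The partial isometry v = w c of the polar decomposition has v * star v <= q,
    with equality because w * star w is invertible in the corner of q. *)
Lemma polar w p q : sproj T p -> sproj T q -> w * p = w -> q * w = w ->
  N (p - st w * w) < 1 -> N (q - w * st w) < 1 ->
  exists v, st v * v = p /\ v * st v = q.
Proof.
move=> hp [sq qq] wp qw /(polar_left hp wp)[c [sc vp Wc]] /neumann[g [gG _ _]].
exists (w * c); split=> //; rewrite bstarM sc.
have wq : st w * q = st w by rewrite -{1}sq -bstarM qw.
set G := 1 - _ in gG.
(* G is invertible and both sides of the goal become w * star w after
   multiplication by G. *)
have Ginj : forall y z, G * y = G * z -> y = z.
  by move=> y z e; rewrite -[y]mul1r -gG -mulrA e mulrA gG mul1r.
apply: Ginj.
have -> : G * q = w * st w by rewrite /G !(mulrBl, mulrBr) mul1r qq -mulrA wq; ncring.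
have -> : G * (w * c * (c * st w)) =
  (w - q * w) * (c * c * st w) + w * (st w * w * (c * c)) * st w.
  by rewrite /G; ncring.
by rewrite qw subrr mul0r add0r Wc wp.
Qed.

Lemma sproj_compl p : sproj T p -> sproj T (1 - p).
Proof.
move=> [sp pp]; split; first by rewrite bstarB bstar1 sp.
by rewrite mulrBl !mulrBr pp; ncring.
Qed.

Lemma sprojD p q : sproj T p -> sproj T q -> p * q = 0 -> sproj T (p + q).
Proof.
move=> [sp pp] [sq qq] pq; split; first by rewrite bstarD sp sq.
have qp : q * p = 0 by rewrite -sp -sq -bstarM pq bstar0.
by rewrite mulrDl !mulrDr pp qq pq qp; ncring.
Qed.

(** The polar part of f * e works, as the defects e - e f e = e (e - f) e and
    f - f e f = f (f - e) f are small. *)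
Lemma close_projections e f C d : sproj T e -> sproj T f ->
  N e <= C -> N f <= C -> N (e - f) <= d -> C * d * C < 1 ->
  exists v, st v * v = e /\ v * st v = f.
Proof.
move=> he hf eC fC ef small; have [se ee] := he; have [sf ff] := hf.
apply: (polar (w := f * e) he hf).
- by rewrite -mulrA ee.
- by rewrite mulrA ff.
- apply: le_lt_trans small; rewrite bstarM se sf.
  have -> : e - e * f * (f * e) = e * (e - f) * e.
    by rewrite mulrBr mulrBl !mulrA ee ee -!mulrA (mulrA f) ff.
  by apply: bnormM_le => //; apply: bnormM_le.
- apply: le_lt_trans small; rewrite bstarM se sf.
  have -> : f - f * e * (e * f) = f * (f - e) * f.
    by rewrite mulrBr mulrBl !mulrA ff ff -!mulrA (mulrA e) ee.
  by apply: bnormM_le => //; apply: bnormM_le => //; rewrite bnormBC.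
Qed.

(** The compression of e to an almost commuting p is almost idempotent:
    a - a ^ 2 = - p e [p, e] p for a = p e p. *)
Lemma compress e p C d : sproj T e -> sproj T p ->
  1 <= C -> N 1 <= C -> N e <= C -> N p <= C ->
  N (p * e - e * p) <= d -> 8 * C ^+ 3 * d <= 1 ->
  exists f, [/\ sproj T f, p * f = f & N (f - p * e * p) <= 12 * C ^+ 7 * d].
Proof.
move=> [se ee] [sp pp] C1 n1 eC pC hd small.
pose a := p * e * p.
have sa : st a = a by rewrite /a !bstarM se sp mulrA.
have aC : N a <= C ^+ 3.
  by rewrite exprSr expr2; apply: bnormM_le => //; apply: bnormM_le.
have ad : N (a - a * a) <= C ^+ 3 * d.
  have -> : a - a * a = - (p * e * (p * e - e * p) * p).
    have -> : a * a = p * e * (p * p) * e * p by rewrite /a; ncring.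
    have -> : p * e * (p * e - e * p) * p = p * e * p * e * p - p * (e * e) * (p * p).
      by ncring.
    by rewrite pp ee /a; ncring.
  rewrite bnormN; have -> : C ^+ 3 * d = C * C * d * C by ring.
  by apply: bnormM_le => //; apply: bnormM_le => //; apply: bnormM_le.
have [|f [hf ann fa]] := near_projection sa; first by lra.
exists f; split => //.
  have /ann : (1 - p) * a = 0 by rewrite /a !mulrA mulrBl pp; ncring.
  by rewrite mulrBl mul1r => /eqP; rewrite subr_eq0 => /eqP <-.
apply: le_trans fa _.
have n0 := bnorm_ge0 T 1; have a0 := bnorm_ge0 T a; have t0 := bnorm_ge0 T (a - a * a).
have C0 : 0 <= C by lra.
have CC : C <= C ^+ 3 by exact: (@ler_weXn2l _ C C1 1 3).
have h1 : 2 * N a + N 1 <= 3 * C ^+ 3 by lra.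
have x0 : 0 <= 2 * N a + N 1 by lra.
have := ler_pM (mulr_ge0 x0 n0) t0 (ler_pM x0 n0 h1 n1) ad.
have -> : 12 * C ^+ 7 * d = 4 * (3 * C ^+ 3 * C * (C ^+ 3 * d)) by ring.
lra.
Qed.

(** The sum of the compressions of e to p and to 1 - p differs from e by
    p [p, e] - [p, e] p. *)
Lemma split_projection e p C d : sproj T e -> sproj T p ->
  1 <= C -> N 1 <= C -> N e <= C -> N p <= C -> N (1 - p) <= C ->
  N (p * e - e * p) <= d -> 104 * C ^+ 9 * d < 1 ->
  exists f g, [/\ [/\ sproj T f, sproj T g, p * f = f & p * g = 0],
    N (f - p * e * p) <= 12 * C ^+ 7 * d
    & exists v, st v * v = e /\ v * st v = f + g].
Proof.
move=> he hp C1 n1 eC pC p'C hd small; have [_ pp] := hp.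
have d0 : 0 <= d by apply: le_trans (bnorm_ge0 T _) hd.
have C0 : 0 <= C by lra.
have mono k : (k <= 9)%N -> C ^+ k * d <= C ^+ 9 * d.
  by move=> k9; apply: ler_wpM2r => //; apply: ler_weXn2l.
have m1 := mono 1%N isT; have m3 := mono 3%N isT; have m7 := mono 7%N isT.
have cd0 : 0 <= C ^+ 9 * d by rewrite mulr_ge0 ?exprn_ge0.
have small3 : 8 * C ^+ 3 * d <= 1 by lra.
have [f [hf pf fn]] := compress he hp C1 n1 eC pC hd small3.
have hd' : N ((1 - p) * e - e * (1 - p)) <= d.
  have -> : (1 - p) * e - e * (1 - p) = - (p * e - e * p) by ncring.
  by rewrite bnormN.
have [g [hg p'g gn]] := compress he (sproj_compl hp) C1 n1 eC p'C hd' small3.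
have pg : p * g = 0 by rewrite -p'g mulrA mulrBr pp; ncring.
have fp : f * p = f by case: hf hp => [sf _] [sp _]; rewrite -{1}sf -sp -bstarM pf sf.
have fg : f * g = 0 by rewrite -fp -mulrA pg mulr0.
have hfg := sprojD hf hg fg.
exists f, g; split => //.
have en : N (e - (f + g)) <= 26 * C ^+ 7 * d.
  have -> : e - (f + g) = (p * (p * e - e * p) - (p * e - e * p) * p)
     - (f - p * e * p) - (g - (1 - p) * e * (1 - p)).
    rewrite !mulrBr !mulrBl !mulrA pp -!mulrA pp; ncring.
  have h1 := bnormM_le pC hd; have h2 := bnormM_le hd pC.
  have := ler_bnormB T (p * (p * e - e * p)) ((p * e - e * p) * p).
  set x := _ - (p * e - e * p) * p.
  have := ler_bnormB T x (f - p * e * p).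
  have := ler_bnormB T (x - (f - p * e * p)) (g - (1 - p) * e * (1 - p)).
  have C17 : C * d <= C ^+ 7 * d.
    by apply: ler_wpM2r => //; exact: (@ler_weXn2l _ C C1 1 7).
  lra.
apply: (close_projections he hfg (C := 2 * C) _ _ en).
- lra.
- have := ler_bnormB T e (e - (f + g)).
  have -> : e - (e - (f + g)) = f + g by ncring.
  lra.
by have -> : 2 * C * (26 * C ^+ 7 * d) * (2 * C) = 104 * C ^+ 9 * d by ring.
Qed.

(** The polar part of f' * v * f. *)
Lemma conjugate_projections f f' p p' v C d : sproj T f -> sproj T f' ->
  sproj T p' -> st v * v = p -> v * st v = p' -> p * f = f -> p' * f' = f' ->
  N f <= C -> N f' <= C -> N v <= C -> N (v * f * st v - f') <= d ->
  C ^+ 4 * d < 1 -> C ^+ 2 * d < 1 ->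
  exists w, st w * w = f /\ w * st w = f'.
Proof.
move=> hf hf' [sp' pp'] vv vv' pf p'f' fC f'C vC hd small small2.
have [sf ff] := hf; have [sf' ff'] := hf'.
apply: (polar (w := f' * v * f) hf hf').
- by rewrite -mulrA ff.
- by rewrite -mulrA mulrA ff'.
- apply: le_lt_trans small.
  have -> : f - st (f' * v * f) * (f' * v * f) =
     f * st v * (v * f * st v - f') * v * f.
    rewrite !bstarM sf sf'.
    have -> : f * (st v * f') * (f' * v * f) = f * st v * (f' * f') * v * f.
      by ncring.
    have -> : f * st v * (v * f * st v - f') * v * f =
      f * (st v * v * f) * (st v * v * f) - f * st v * f' * v * f by ncring.
    by rewrite ff' vv pf !ff.
  have -> : C ^+ 4 * d = C * C * d * C * C by ring.
  by do !apply: bnormM_le => //; rewrite bnorm_star.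
apply: le_lt_trans small2.
have -> : f' - f' * v * f * st (f' * v * f) = - (f' * (v * f * st v - f') * f').
  rewrite !bstarM sf sf'.
  have -> : f' * v * f * (f * (st v * f')) = f' * v * (f * f) * st v * f' by ncring.
  rewrite ff mulrBr mulrBl ff' ff'; ncring.
rewrite bnormN; have -> : C ^+ 2 * d = C * d * C by ring.
by do !apply: bnormM_le => //.
Qed.

End EquivalentProjections.

(** * C*-algebras as complete normed *-rings *)

Section RealScalars.
Variables (R : realType) (A : cstarAlgType R).
Implicit Types (a b c x y z : A).

Lemma cnormZR (r : R) x : cnorm (r%:C *: x) = `|r| * cnorm x.
Proof.
apply: complexI; rewrite cnormZ [RHS]rmorphM; congr (_ * _).
by rewrite normc_def /= expr0n addr0 sqrtr_sqr.
Qed.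

Lemma cnormN x : cnorm (- x) = cnorm x.
Proof.
by have := cnormZR (-1) x; rewrite rmorphN rmorph1 scaleN1r normrN1 mul1r.
Qed.

Lemma cnorm_ge0 x : 0 <= cnorm x.
Proof.
have := ler_cnormD x (- x); have := ler_cnormD (0 : A) 0.
rewrite cnormN subrr addr0; lra.
Qed.

Lemma cnorm0 : cnorm (0 : A) = 0.
Proof. by have := cnormZR 0 0; rewrite scaler0 normr0 mul0r. Qed.

(** The C*-identity gives |z| ^ 2 <= |star z| |z|. *)
Lemma cnorm_star x : cnorm (star x) = cnorm x.
Proof.
have le z : cnorm z <= cnorm (star z).
  have := ler_cnormM (star z) z; rewrite cnorm_starM => h.
  have [z0|z0] := eqVneq (cnorm z) 0; first by rewrite z0 cnorm_ge0.
  have zp : 0 < cnorm z by rewrite lt_neqAle eq_sym z0 cnorm_ge0.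
  by rewrite -(ler_pM2r zp) -expr2.
by apply/eqP; rewrite eq_le -{2}(starK x) !le.
Qed.

Lemma cnormB x y : cnorm (x - y) <= cnorm x + cnorm y.
Proof. by have := ler_cnormD x (- y); rewrite cnormN. Qed.

(** Real scalars as elements of A, so that identities with scalars are
    identities of the ring. *)
Definition rscalar (r : R) : A := r%:C *: 1.

Local Notation rs := rscalar.

Lemma rsM r s : rs (r * s) = rs r * rs s.
Proof. by rewrite /rscalar -scalerAl mul1r scalerA rmorphM. Qed.

Lemma rsD r s : rs (r + s) = rs r + rs s.
Proof. by rewrite /rscalar rmorphD scalerDl. Qed.

Lemma rsN r : rs (- r) = - rs r.
Proof. by rewrite /rscalar rmorphN scaleNr. Qed.

Lemma rs0 : rs 0 = 0. Proof. by rewrite /rscalar rmorph0 scale0r. Qed.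

Lemma rs1 : rs 1 = 1. Proof. by rewrite /rscalar rmorph1 scale1r. Qed.

Lemma rsC r x : rs r * x = x * rs r.
Proof. by rewrite /rscalar -scalerAl -scalerAr mul1r mulr1. Qed.

Lemma star_rs r : star (rs r) = rs r.
Proof.
rewrite /rscalar starZ star1; congr (_ *: _); apply: conj_Creal.
by rewrite complex_real.
Qed.

Lemma cnorm_rsM r x : cnorm (rs r * x) = `|r| * cnorm x.
Proof. by rewrite /rscalar -scalerAl mul1r cnormZR. Qed.

Lemma cnorm1 : cnorm (1 : A) = 1.
Proof.
have := cnorm_starM (1 : A); rewrite star1 mulr1 expr2 => e.
have /eqP : cnorm (1 : A) * (1 - cnorm (1 : A)) = 0 by rewrite mulrBr -e mulr1 subrr.
rewrite mulf_eq0 subr_eq0 => /orP[/eqP /cnorm0_eq0 /eqP|/eqP //].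
by rewrite oner_eq0.
Qed.

Lemma cnorm_rs r : cnorm (rs r) = `|r|.
Proof. by rewrite -[rs r]mulr1 cnorm_rsM cnorm1 mulr1. Qed.

Lemma cnorm_entourage (e : R) : 0 < e ->
  entourage [set xy : A * A | cnorm (xy.1 - xy.2) < e].
Proof. by move=> e0; rewrite cnorm_entourageE; exists e. Qed.

(** The majorant is nondecreasing and bounded, hence convergent, and it controls
    all the differences u m - u n. *)
Lemma ccomplete (u : nat -> A) (b : nat -> R) (c : R) :
  (forall n, cnorm (u n.+1 - u n) <= b n.+1 - b n) -> (forall n, b n <= c) ->
  exists l : A, (fun n => cnorm (u n - l)) @ \oo --> (0 : R).
Proof.
move=> ub bc.
have ubm n m : (n <= m)%N -> cnorm (u m - u n) <= b m - b n.
  move=> /subnK <-; elim: (m - n)%N => [|k IH].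
    by rewrite add0n !subrr cnorm0.
  rewrite addSn; have -> : u (k + n).+1 - u n = (u (k + n).+1 - u (k + n)%N) + (u (k + n)%N - u n).
    by ncring.
  apply: le_trans (ler_cnormD _ _) _; have := ub (k + n)%N; lra.
have bnd : {homo b : n m / (n <= m)%N >-> n <= m}.
  by move=> n m /ubm; have := cnorm_ge0 (u m - u n); lra.
have bcv : cvgn b.
  apply: nondecreasing_is_cvgn => //; exists c => _ [n _ <-]; exact: bc.
have blim n : b n <= limn b by apply: nondecreasing_cvgn_le.
have near_lim e : 0 < e -> exists n0, forall n, (n0 <= n)%N -> limn b - b n < e.
  move=> e0; have /cvgrPdist_lt /(_ e e0)[n0 _ hn0] := bcv.
  exists n0 => n /hn0; exact: le_lt_trans (ler_norm _).
have ucau : cauchy (u @ \oo).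
  move=> E; rewrite cnorm_entourageE => -[e e0 eE].
  have [|n0 hn0] := near_lim (e / 2); first by move: e0 => /=; lra.
  pose S := [set x | exists2 n, (n0 <= n)%N & x = u n].
  have FS : (u @ \oo) S by exists n0 => // n /= hn; exists n.
  exists (S, S) => // -[_ _] [/= [n hn ->] [m hm ->]]; apply: eE => /=.
  have := hn0 n0 (leqnn _); have := ubm _ _ hn; have := ubm _ _ hm.
  have := blim n; have := blim m.
  have := cnormB (u n - u n0) (u m - u n0).
  have -> : u n - u n0 - (u m - u n0) = u n - u m by ncring.
  lra.
have [l ul] := cnorm_complete _ _ ucau.
exists l; apply/cvgrPdist_lt => e e0.
have [n0 _ hn0] : \forall n \near \oo, cnorm (l - u n) < e.
  by have /cvg_entourage /(_ _ (cnorm_entourage e0)) := ul.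
exists n0 => // n /hn0 /=; rewrite sub0r normrN ger0_norm ?cnorm_ge0 //.
by rewrite -cnormN opprB.
Qed.

Definition cstarBanach : banachStar R A.
Proof.
exists (@cnorm R A) (@star R A) (rs 2^-1).
- exact: ler_cnormD.
- exact: cnormN.
- exact: cnorm0_eq0.
- exact: ler_cnormM.
- exact: starD.
- exact: starM.
- exact: starK.
- exact: cnorm_star.
- by rewrite -rsD -rs1; congr rs; field.
- exact: rsC.
- by move=> x; rewrite cnorm_rsM gtr0_norm ?invr_gt0 ?ltr0n // mulrC.
- exact: ccomplete.
Defined.

Local Notation N := (@cnorm R A).

Lemma starB x y : star (x - y) = star x - star y.
Proof. exact: (bstarB cstarBanach). Qed.

Lemma cnorm_sa a : star a = a -> N (a * a) = N a ^+ 2.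
Proof. by move=> sa; rewrite -cnorm_starM sa. Qed.

(** The imaginary unit as a central element of A. *)
Definition im_unit : A := 'i%C *: 1.

Lemma im_unitC x : x * im_unit = im_unit * x.
Proof. by rewrite /im_unit -scalerAl -scalerAr mul1r mulr1. Qed.

Lemma im_unit2 : im_unit * im_unit = - 1.
Proof. by rewrite /im_unit -scalerAl mul1r scalerA -expr2 sqr_i scaleN1r. Qed.

Lemma star_im_unit : star im_unit = - im_unit.
Proof.
rewrite /im_unit starZ star1 -scaleNr; congr (_ *: _).
by rewrite complexiE conjCi.
Qed.

Lemma im_prod a c : (a - im_unit * c) * (a + im_unit * c) =
  a * a + c * c + im_unit * (a * c - c * a).
Proof.
have -> : (a - im_unit * c) * (a + im_unit * c) =
  a * a + (a * im_unit) * c - im_unit * c * a - im_unit * (c * im_unit) * c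
  by ncring.
rewrite !im_unitC.
have -> : im_unit * (im_unit * c) * c = (im_unit * im_unit) * c * c by ncring.
by rewrite im_unit2; ncring.
Qed.

(** For commuting self-adjoint a and c, the element u = a + i c satisfies
    star u * u = a ^ 2 + c ^ 2, and 2 a = star u + u. *)
Lemma cnorm_sum_squares a c : star a = a -> star c = c -> a * c = c * a ->
  N a ^+ 2 <= N (a * a + c * c).
Proof.
move=> sa sc ac; pose u := a + im_unit * c.
have su : star u = a - im_unit * c.
  by rewrite starD starM sa sc star_im_unit mulrN im_unitC.
have uu : star u * u = a * a + c * c by rewrite su im_prod ac subrr mulr0 addr0.
have := cnormB (star u) (- u); rewrite opprK cnormN cnorm_star.
have -> : star u + u = rs 2 * a.
  by rewrite su -[2]/(1 + 1) rsD rs1 /u; ncring.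
rewrite cnorm_rsM ger0_norm // => h.
rewrite -uu cnorm_starM ler_pXn2r ?nnegrE ?cnorm_ge0 //; lra.
Qed.

(** A substitute for the function c = sqrt (r ^ 2 - a ^ 2) of a. *)
Lemma sq_compl a (r : R) : star a = a -> N a <= r ->
  exists c, [/\ star c = c, a * a + c * c = rs (r ^+ 2)
             & forall z, z * a = a * z -> z * c = c * z].
Proof.
move=> sa ar; have r0 : 0 <= r by apply: le_trans (cnorm_ge0 a) ar.
have [r00|rn0] := eqVneq r 0.
  exists 0; split=> //; first exact: star0.
    have -> : a = 0 by apply: cnorm0_eq0; have := cnorm_ge0 a; lra.
    by rewrite r00 expr0n rs0; ncring.
  by move=> z _; rewrite mulr0 mul0r.
(* Normalize to |a'| <= 1, where sqrt_exists applies to x = a' ^ 2. *)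
pose a' := rs r^-1 * a.
have rp : 0 < r by rewrite lt_neqAle eq_sym rn0.
have a1 : N (a' * a') <= 1.
  have na' : N a' <= 1.
    by rewrite cnorm_rsM gtr0_norm ?invr_gt0 // mulrC ler_pdivrMr // mul1r.
  by have := bnormM_le (T := cstarBanach) na' na'; rewrite mulr1.
have [y [_ sq comm _ sy]] := sqrt_exists (T := cstarBanach) a1.
have sa' : star a' = a' by rewrite starM sa star_rs -rsC.
have ra : rs r * a' = a by rewrite mulrA -rsM divff // rs1 mul1r.
exists (rs r * (1 - y)); split.
- rewrite starM star_rs -rsC starB star1; congr (_ * (_ - _)).
  by apply: sy; rewrite [LHS]starM sa'.
- rewrite -ra; set r' := rs r.
  have -> : r' * a' * (r' * a') + r' * (1 - y) * (r' * (1 - y)) =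
    r' * (a' * r') * a' + r' * ((1 - y) * r') * (1 - y) by ncring.
  rewrite -!rsC.
  have -> : r' * (r' * a') * a' + r' * (r' * (1 - y)) * (1 - y) =
    r' * r' * (a' * a' + (1 - y) * (1 - y)) by ncring.
  by rewrite sq -rsM expr2; ncring.
- move=> z za.
  have za' : z * a' = a' * z by rewrite mulrA -rsC -!mulrA za.
  have /comm zy : z * (a' * a') = a' * a' * z by rewrite mulrA za' -mulrA za' mulrA.
  by rewrite mulrA -rsC -!mulrA; congr (_ * _); rewrite mulrBr mulrBl zy; ncring.
Qed.

End RealScalars.

(** * Positive elements *)

Section Positivity.
Variables (R : realType) (A : cstarAlgType R).
Implicit Types (a b c x y z : A).
Local Notation N := (@cnorm R A).
Local Notation rs := (@rscalar R A).

(** For self-adjoint a, write a ^ 2 + c ^ 2 = |a| ^ 2.  The image of this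
    equation under alpha bounds the norm of alpha a. *)
Lemma starAut_contraction (alpha : starAut A) x : N (alpha x) <= N x.
Proof.
have sa_case a : star a = a -> N (alpha a) <= N a.
  move=> sa; have [c [sc ac comm]] := sq_compl sa (lexx _).
  have ars : alpha (a * a + c * c) = rs (N a ^+ 2).
    by rewrite ac /rscalar linearZ rmorph1.
  have : N (alpha a) ^+ 2 <= N (alpha (a * a + c * c)).
    rewrite rmorphD !rmorphM; apply: cnorm_sum_squares.
    - by rewrite -starAut_star sa.
    - by rewrite -starAut_star sc.
    - by rewrite -!rmorphM (comm a).
  rewrite ars.
  rewrite cnorm_rs ger0_norm ?exprn_ge0 ?cnorm_ge0 //.
  by rewrite ler_pXn2r ?nnegrE ?cnorm_ge0.
have := sa_case (star x * x).
rewrite starM starK rmorphM /= starAut_star !cnorm_starM => /(_ erefl).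
by rewrite ler_pXn2r ?nnegrE ?cnorm_ge0.
Qed.

(** Positivity without reference to the spectrum. *)
Definition psd a := exists2 b, star b = b & b * b = a.

Lemma psd_star a : psd a -> star a = a.
Proof. by case=> b sb <-; rewrite starM sb. Qed.

(** If a = b ^ 2 then t - a = c ^ 2, where c commutes with b; the bound is
    [cnorm_sum_squares]. *)
Lemma psd_norm a t : psd a -> N a <= t -> N (rs t - a) <= t.
Proof.
move=> [b sb <-] bt; have t0 : 0 <= t by apply: le_trans (cnorm_ge0 _) bt.
have bs : N b <= Num.sqrt t.
  by rewrite -(ler_pXn2r (n := 2)) ?nnegrE ?cnorm_ge0 ?sqrtr_ge0 // sqr_sqrtr // -cnorm_sa.
have [c [sc bc comm]] := sq_compl sb bs.
rewrite sqr_sqrtr // in bc.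
have -> : rs t - b * b = c * c by rewrite -bc; ncring.
rewrite cnorm_sa //; apply: le_trans (@cnorm_sum_squares R A c b sc sb _) _.
  by rewrite (comm b).
by rewrite addrC bc cnorm_rs ger0_norm.
Qed.

(** The norm condition says that a / t = 1 - x with |x| <= 1.  The bound on b
    shows that the root is itself positive. *)
Lemma psd_sqrt a t : star a = a -> N (rs t - a) <= t ->
  exists b, [/\ star b = b, b * b = a, N (rs (Num.sqrt t) - b) <= Num.sqrt t
              & forall z, z * a = a * z -> z * b = b * z].
Proof.
move=> sa at_; have t0 : 0 <= t by apply: le_trans (cnorm_ge0 _) at_.
have [t00|tn0] := eqVneq t 0.
  exists 0; have a0 : a = 0.
    apply: cnorm0_eq0; move: at_; rewrite t00 rs0 sub0r cnormN.
    have := cnorm_ge0 a; lra.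
  by split=> [|||z _]; rewrite ?star0 ?mulr0 ?mul0r ?a0 // subr0 cnorm_rs ger0_norm.
have tp : 0 < t by rewrite lt_neqAle eq_sym tn0.
pose x := rs t^-1 * (rs t - a).
have x1 : N x <= 1.
  by rewrite cnorm_rsM gtr0_norm ?invr_gt0 // mulrC ler_pdivrMr // mul1r.
have sx : star x = x by rewrite starM starB !star_rs sa -rsC.
have [y [yx sq comm _ sy]] := sqrt_exists (T := cstarBanach A) x1.
have {}sy : star y = y := sy sx.
have y1 : N y <= 1 := le_trans yx x1.
pose s := rs (Num.sqrt t).
exists (s * (1 - y)); split.
- by rewrite starM star_rs -rsC starB star1 sy.
- have -> : s * (1 - y) * (s * (1 - y)) = s * ((1 - y) * s) * (1 - y) by ncring.
  rewrite -rsC; have -> : s * (s * (1 - y)) * (1 - y) = s * s * ((1 - y) * (1 - y)).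
    by ncring.
  rewrite sq -rsM -expr2 sqr_sqrtr // mulrBr mulr1 mulrA -rsM divff // rs1; ncring.
- have -> : rs (Num.sqrt t) - s * (1 - y) = s * y by rewrite /s; ncring.
  by rewrite cnorm_rsM ger0_norm ?sqrtr_ge0 // ler_piMr ?sqrtr_ge0.
- move=> z za.
  have /comm zy : z * x = x * z.
    by rewrite mulrA -rsC -!mulrA; congr (_ * _); rewrite mulrBr mulrBl za rsC.
  by rewrite mulrA -rsC -!mulrA; congr (_ * _); rewrite mulrBr mulrBl zy; ncring.
Qed.

Lemma psd_of_norm a t : star a = a -> N (rs t - a) <= t -> psd a.
Proof. by move=> sa /(psd_sqrt sa)[b [sb ba _]]; exists b. Qed.

(** The norm characterization is additive. *)
Lemma psdD a b : psd a -> psd b -> psd (a + b).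
Proof.
move=> ha hb; have [sa sb] := (psd_star ha, psd_star hb).
have na := psd_norm ha (lexx _); have nb := psd_norm hb (lexx _).
apply: (@psd_of_norm _ (N a + N b)); first by rewrite starD sa sb.
have -> : rs (N a + N b) - (a + b) = (rs (N a) - a) + (rs (N b) - b).
  by rewrite rsD; ncring.
by apply: le_trans (ler_cnormD _ _) _; apply: lerD.
Qed.

Lemma psd_sq b : star b = b -> psd (b * b).
Proof. by exists b. Qed.

Lemma invertible_lr l x r : l * x = 1 -> x * r = 1 -> invertible x.
Proof.
move=> lx xr; exists l; split=> //.
suff -> : l = r by [].
by rewrite -[l]mulr1 -xr mulrA lx mul1r.
Qed.

Lemma invertible_commM x y : x * y = y * x -> invertible (x * y) -> invertible x.
Proof.
move=> xy [g [g1 g2]]; apply: (@invertible_lr (g * y) _ (y * g)).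
  by rewrite -mulrA -xy.
by rewrite mulrA.
Qed.

Lemma invertibleN x : invertible x -> invertible (- x).
Proof. by move=> [g [g1 g2]]; exists (- g); rewrite !mulrNN. Qed.

Lemma invertible_near1 x : N x < 1 -> invertible (1 - x).
Proof. by case/(@neumann _ _ (cstarBanach A)) => c [c1 c2 _]; exists c. Qed.

Lemma invertible_rsM r x : r != 0 -> invertible x -> invertible (rs r * x).
Proof.
move=> r0 [g [g1 g2]]; exists (rs r^-1 * g).
have e (u v : A) s s' : rs s * u * (rs s' * v) = rs (s * s') * (u * v).
  have -> : rs s * u * (rs s' * v) = rs s * (u * rs s') * v by ncring.
  by rewrite -rsC rsM; ncring.
by rewrite !e mulVf // divff // rs1 g1 g2 mulr1.
Qed.

(** r + b = (r + t) (1 - x) with |x| <= t / (r + t), where t = |b|. *)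
Lemma psd_add_invertible b r : psd b -> 0 < r -> invertible (rs r + b).
Proof.
move=> hb r0; set t := N b; have t0 : 0 <= t := cnorm_ge0 b.
have tn := psd_norm hb (lexx t).
have -> : rs r + b = rs (r + t) * (1 - rs (r + t)^-1 * (rs t - b)).
  by rewrite mulrBr mulrA -rsM divff ?rs1 ?rsD ?mulr1; [ncring|lra].
apply: invertible_rsM; first lra.
apply: invertible_near1; rewrite cnorm_rsM gtr0_norm ?invr_gt0; last lra.
rewrite mulrC ltr_pdivrMr; lra.
Qed.

(** The product with a - i s is a ^ 2 + s ^ 2, which is invertible. *)
Lemma sa_add_im_invertible a (s : R) : star a = a -> s != 0 ->
  invertible (a + im_unit A * rs s).
Proof.
move=> sa s0; set j := im_unit A.
have e1 : (a - j * rs s) * (a + j * rs s) = a * a + rs s * rs s.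
  by rewrite im_prod rsC subrr mulr0 addr0.
have e2 : (a + j * rs s) * (a - j * rs s) = a * a + rs s * rs s.
  have := im_prod a (- rs s).
  by rewrite !mulrN !mulNr !opprK (rsC s a) addNr mulr0 addr0.
apply: (@invertible_commM _ (a - j * rs s)); first by rewrite e1 e2.
rewrite e2 -rsM addrC; apply: psd_add_invertible; first exact: psd_sq.
by rewrite -expr2 exprn_even_gt0.
Qed.

(** A non-real z is treated by [sa_add_im_invertible], and a negative one by
    [psd_add_invertible]. *)
Lemma sq_positive a : star a = a -> positive (a * a).
Proof.
move=> sa; split; first by rewrite starM sa.
move=> [x y] /= hz; apply: contrapT => zn; apply: hz.
have -> : (x +i* y)%:A - a * a = (rs x - a * a) + im_unit A * rs y.
  have -> : (x +i* y)%:A = rs x + im_unit A * rs y.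
    by rewrite [x +i* y]complexE /= scalerDl /im_unit /rscalar -scalerAl mul1r scalerA.
  ncring.
have saa : star (rs x - a * a) = rs x - a * a by rewrite starB star_rs starM sa.
have [y0|y0] := eqVneq y 0; last exact: sa_add_im_invertible.
have x0 : x < 0.
  by rewrite ltNge; apply/negP => x0; apply: zn; rewrite y0 lecE /= eqxx.
rewrite y0 rs0 mulr0 addr0 -opprB -[x]opprK rsN opprK addrC.
by apply/invertibleN/psd_add_invertible; [apply: psd_sq|lra].
Qed.

Lemma psdZ r a : psd a -> 0 <= r -> psd (rs r * a).
Proof.
move=> [b sb <-] r0; exists (rs (Num.sqrt r) * b).
  by rewrite starM star_rs sb -rsC.
set s := rs _; have -> : s * b * (s * b) = s * (b * s) * b by ncring.
rewrite -rsC; have -> : s * (s * b) * b = (s * s) * (b * b) by ncring.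
by rewrite -rsM -expr2 sqr_sqrtr.
Qed.

(** If |a| - a = d ^ 2 were invertible, it would stay positive after subtracting
    a small e > 0; then a + (|a| - e - a) = |a| - e is a sum of two commuting
    squares, and [cnorm_sum_squares] bounds |a| by |a| - e. *)
Lemma norm_in_spectrum a : psd a -> a != 0 -> ~ invertible (rs (N a) - a).
Proof.
move=> ha a0 [g]; set t := N a; set D := rs t - a => -[gD Dg].
have sa := psd_star ha.
have t0 : 0 < t.
  by rewrite lt_neqAle cnorm_ge0 andbT eq_sym; apply: contra_neq a0; apply: cnorm0_eq0.
have sD : star D = D by rewrite starB star_rs sa.
have [d [sd dD _ dcomm]] : exists b, [/\ star b = b, b * b = D,
    N (rs (Num.sqrt t) - b) <= Num.sqrt t & forall z, z * D = D * z -> z * b = b * z].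
  by apply: psd_sqrt => //; rewrite /D opprB addrC subrK.
have [b [sb ba _ bcomm]] := psd_sqrt sa (psd_norm ha (lexx _)).
have sg : star g = g.
  have := congr1 star Dg; rewrite starM sD star1 => sgD.
  by rewrite -[LHS]mulr1 -Dg mulrA sgD mul1r.
(* Small enough for both e |g| <= 1 and e <= t. *)
pose e := t / (t * N g + 1).
have ng : 0 <= N g := cnorm_ge0 g.
have tg : 0 <= t * N g by rewrite mulr_ge0 // ltW.
have e0 : 0 < e by rewrite divr_gt0 //; lra.
have et : e <= t by rewrite ler_pdivrMr; [nra|lra].
have eg : e * N g <= 1 by rewrite mulrAC ler_pdivrMr; lra.
(* As g inverts D, D * E = D - e; so D - e is the square of d k. *)
pose E := 1 - rs e * g.
have sE : star E = E by rewrite starB star1 starM star_rs sg -rsC.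
have [k [sk kE _ kcomm]] : exists b, [/\ star b = b, b * b = E,
    N (rs (Num.sqrt 1) - b) <= Num.sqrt 1 & forall z, z * E = E * z -> z * b = b * z].
  apply: psd_sqrt => //; rewrite rs1 /E opprB addrC subrK cnorm_rsM.
  by rewrite ger0_norm // ltW.
have commE z : z * D = D * z -> z * k = k * z.
  move=> zD; apply: kcomm; rewrite /E mulrBr mulrBl mulr1 mul1r; congr (_ - _).
  rewrite mulrA -rsC -!mulrA; congr (_ * _).
  by rewrite -[LHS]mul1r -gD -mulrA (mulrA D) -zD -mulrA Dg mulr1.
have dk : d * k = k * d by apply: commE; rewrite -dD mulrA.
have bD : b * D = D * b by rewrite /D mulrBr mulrBl -rsC -ba mulrA.
have bd := dcomm _ bD; have bk := commE _ bD.
have := @cnorm_sum_squares R A b (d * k) sb.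
rewrite starM sd sk -dk -mulrA -bk mulrA bd mulrA => /(_ erefl erefl).
have -> : d * k * (d * k) = d * d * (k * k).
  by rewrite -mulrA (mulrA k) -dk; ncring.
rewrite kE dD -cnorm_sa // ba.
have -> : a + D * E = rs (t - e).
  have -> : a + D * E = rs t - D * rs e * g by rewrite /E /D; ncring.
  by rewrite -rsC -mulrA Dg mulr1 rsD rsN.
rewrite cnorm_rs ger0_norm; rewrite -/t; lra.
Qed.

(** The inverse is (1 - w' g w) / r, where g inverts r + w w'. *)
Lemma invertible_jacobson w w' r : r != 0 ->
  invertible (rs r + w * w') -> invertible (rs r + w' * w).
Proof.
move=> r0 [g [g1 g2]].
have rr : rs r^-1 * rs r = 1 by rewrite -rsM mulVf // rs1.
have rr' : rs r * rs r^-1 = 1 by rewrite -rsM divff // rs1.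
exists (rs r^-1 * (1 - w' * g * w)); split.
  have -> : rs r^-1 * (1 - w' * g * w) * (rs r + w' * w) =
     rs r^-1 * rs r + rs r^-1 * (w' * w - w' * g * (w * rs r) - w' * g * w * w' * w).
    by ncring.
  rewrite -(rsC r w).
  have -> : w' * w - w' * g * (rs r * w) - w' * g * w * w' * w =
     w' * w - w' * (g * (rs r + w * w')) * w by ncring.
  by rewrite g1 rr; ncring.
rewrite (rsC r^-1).
have -> : (rs r + w' * w) * ((1 - w' * g * w) * rs r^-1) =
    (rs r + w' * w - (rs r * w') * g * w - w' * w * w' * g * w) * rs r^-1.
  by ncring.
rewrite (rsC r w').
have -> : rs r + w' * w - w' * rs r * g * w - w' * w * w' * g * w =
   rs r + w' * w - w' * ((rs r + w * w') * g) * w by ncring.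
by rewrite g2 mulr1 addrK.
Qed.

(** The classical argument of Kaplansky.  Let u = |a| be the positive root of
    a ^ 2 for a = star y * y, and n = u - a twice the negative part.  Then
    w = y n satisfies star w * w = - v ^ 2 with v self-adjoint, whereas
    w * star w = (star w * w + w * star w) + v ^ 2 is positive, being a sum of
    squares.  As r + w * star w and r + star w * w are invertible together, no
    r > 0 is in the spectrum of v ^ 2, so that v = 0, whence n ^ 3 = 0. *)
Lemma psd_star_mul y : psd (star y * y).
Proof.
set a := star y * y; have sa : star a = a by rewrite starM starK.
have haa := psd_sq sa.
have [u [su ua un ucomm]] := psd_sqrt (psd_star haa) (psd_norm haa (lexx _)).
have hu := psd_of_norm su un.
have [m [sm mu _ mcomm]] := psd_sqrt su un.
have au : a * u = u * a by apply: ucomm; rewrite mulrA.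
pose n := u - a; have sn : star n = n by rewrite starB su sa.
have nu : n * u = u * n by rewrite /n mulrBl mulrBr au.
have nm := mcomm _ nu.
have nna : n * u = - (n * a).
  apply/eqP; rewrite -subr_eq0 opprK; apply/eqP.
  have -> : n * u + n * a = u * u - a * a + (u * a - a * u) by rewrite /n; ncring.
  by rewrite ua au !subrr addr0.
pose v := n * m; have sv : star v = v by rewrite starM sm sn -nm.
have vv : v * v = n * u * n.
  have -> : v * v = n * m * (m * n) by rewrite -nm.
  by rewrite -mu; ncring.
pose w := y * n; have ww : star w * w = - (v * v).
  have -> : star w * w = n * a * n by rewrite /w starM sn /a; ncring.
  by rewrite vv nna; ncring.
(* In terms of the real and imaginary parts of w. *)
have sumww : psd (star w * w + w * star w).
  pose j := im_unit A.
  pose s1 := w + star w; pose s2 := j * (w - star w).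
  have ss1 : star s1 = s1 by rewrite starD starK addrC.
  have ss2 : star s2 = s2.
    by rewrite starM starB starK star_im_unit mulrN im_unitC -mulrN opprB.
  have := psdZ (psdD (psd_sq ss1) (psd_sq ss2)) (_ : 0 <= 2^-1).
  have -> : s1 * s1 + s2 * s2 = rs 2 * (star w * w + w * star w).
    have -> : s2 * s2 = j * ((w - star w) * j) * (w - star w) by rewrite /s2; ncring.
    rewrite im_unitC mulrA im_unit2 -[2]/(1 + 1) rsD rs1 /s1; ncring.
  by rewrite mulrA -rsM mulVf // rs1 mul1r; apply; rewrite invr_ge0.
have hww : psd (w * star w).
  have -> : w * star w = (star w * w + w * star w) + v * v by rewrite ww; ncring.
  exact: psdD (psd_sq sv).
have vv0 : v * v = 0.
  apply/eqP; apply: contrapT => /negP vn0.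
  apply: (norm_in_spectrum (psd_sq sv) vn0).
  have np : 0 < N (v * v).
    by rewrite lt_neqAle cnorm_ge0 andbT eq_sym; apply: contra_neq vn0; apply: cnorm0_eq0.
  rewrite -ww; apply: invertible_jacobson; first by rewrite gt_eqF.
  exact: psd_add_invertible.
(* n ^ 2 = n u - n a = 2 n u. *)
have n3 : n * n * n = 0.
  have -> : n * n = n * u + n * u by rewrite {2}nna /n; ncring.
  by rewrite mulrDl -vv vv0 addr0.
have n0 : n = 0.
  have : N n ^+ 2 ^+ 2 = 0.
    by rewrite -!cnorm_sa ?starM ?sn // mulrA n3 mul0r cnorm0.
  by move=> /eqP; rewrite !expf_eq0 /= => /eqP/cnorm0_eq0.
have -> : a = u by apply/eqP; rewrite eq_sym -subr_eq0 -/n n0.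
exact: hu.
Qed.

End Positivity.

(** * Projections in simple algebras *)

Section Projections.
Variables (R : realType) (A : cstarAlgType R).
Implicit Types (a b c p q r x y z : A).
Local Notation N := (@cnorm R A).
Local Notation rs := (@rscalar R A).

Lemma cnorm_closureP (S : set A) x :
  closure S x <-> forall e : R, 0 < e -> exists2 s, S s & N (x - s) < e.
Proof.
split=> [Sx e e0|h B].
  have [s [Ss /xsectionP /= xs]] := Sx _ (nbhs_entourage x (cnorm_entourage A e0)).
  by exists s.
move=> /nbhsP[E entE EB]; move: entE; rewrite cnorm_entourageE => -[e e0 eE].
have [s Ss xs] := h e e0; exists s; split => //.
by apply/EB/xsectionP/eE.
Qed.

Lemma cnorm_eps_eq0 z (K : R) : (forall e : R, 0 < e -> N z <= K * e) -> z = 0.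
Proof.
move=> h; apply: cnorm0_eq0; apply/eqP; rewrite eq_le cnorm_ge0 andbT.
apply/ler_addgt0Pl => e e0; rewrite addr0.
have K0 : 0 < `|K| + 1 by have := normr_ge0 K; lra.
have := h (e / (`|K| + 1)) (divr_gt0 e0 K0).
have : K * (e / (`|K| + 1)) <= e.
  rewrite mulrA ler_pdivrMr // mulrC ler_wpM2l //; last by have := ler_norm K; lra.
  exact: ltW.
lra.
Qed.

Lemma star_mul_eq0 z : star z * z = 0 -> z = 0.
Proof.
move=> z0; apply: cnorm0_eq0.
by have := cnorm_starM z; rewrite z0 cnorm0 => /esym/eqP; rewrite expf_eq0 => /eqP.
Qed.

Lemma proj_compl p : is_projection p -> is_projection (1 - p).
Proof. by move=> hp; apply: (sproj_compl (T := cstarBanach A)). Qed.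

Lemma proj_norm p : is_projection p -> p != 0 -> N p = 1.
Proof.
move=> [sp pp] p0; have np : N p != 0 by apply: contra_neq p0; apply: cnorm0_eq0.
by apply: (mulfI np); rewrite mulr1 -expr2 -cnorm_sa ?pp.
Qed.

Lemma proj_norm_le1 p : is_projection p -> N p <= 1.
Proof.
move=> hp; have [->|p0] := eqVneq p 0; first by rewrite cnorm0.
by rewrite proj_norm.
Qed.

Lemma sa_left_right p a : star p = p -> star a = a -> p * a = a -> a * p = a.
Proof. by move=> sp sa pa; rewrite -[LHS]starK starM sp sa pa. Qed.

(** The closure of the algebraic ideal generated by p is everything, so some
    element of that ideal is close to 1 and thus invertible. *)
Lemma full_projection p : simple A -> p != 0 ->
  exists n (a b : 'I_n -> A), \sum_(i < n) a i * p * b i = 1.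
Proof.
move=> simA p0.
pose I := [set x | exists s : seq (A * A), x = \sum_(u <- s) u.1 * p * u.2].
have ID x y : I x -> I y -> I (x + y).
  by move=> [s ->] [t ->]; exists (s ++ t); rewrite big_cat.
have IMl a x : I x -> I (a * x).
  move=> [s ->]; exists [seq (a * u.1, u.2) | u <- s].
  by rewrite big_map mulr_sumr; apply: eq_bigr => u _ /=; rewrite !mulrA.
have IMr a x : I x -> I (x * a).
  move=> [s ->]; exists [seq (u.1, u.2 * a) | u <- s].
  by rewrite big_map mulr_suml; apply: eq_bigr => u _ /=; rewrite !mulrA.
have Ip : I p by exists [:: (1, 1)]; rewrite big_seq1 mul1r mulr1.
have pos a : 0 < N a + 1 by have := cnorm_ge0 a; lra.
have idl : two_sided_ideal (closure I).
  split.
  - apply/cnorm_closureP => e e0; exists 0; first by exists [::]; rewrite big_nil.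
    by rewrite subrr cnorm0.
  - move=> x y /cnorm_closureP hx /cnorm_closureP hy; apply/cnorm_closureP => e e0.
    have e2 : 0 < e / 2 by lra.
    have [s Is xs] := hx _ e2; have [t It yt] := hy _ e2.
    exists (s + t); first exact: ID.
    have -> : x + y - (s + t) = (x - s) + (y - t) by ncring.
    apply: le_lt_trans (ler_cnormD _ _) _; lra.
  - move=> a x /cnorm_closureP hx; apply/cnorm_closureP => e e0.
    have [s Is xs] := hx _ (divr_gt0 e0 (pos a)); exists (a * s); first exact: IMl.
    rewrite -mulrBr; apply: le_lt_trans (ler_cnormM _ _) _.
    move: xs; rewrite ltr_pdivlMr //; have := cnorm_ge0 (x - s); have := cnorm_ge0 a; nra.
  - move=> a x /cnorm_closureP hx; apply/cnorm_closureP => e e0.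
    have [s Is xs] := hx _ (divr_gt0 e0 (pos a)); exists (s * a); first exact: IMr.
    rewrite -mulrBl; apply: le_lt_trans (ler_cnormM _ _) _.
    move: xs; rewrite ltr_pdivlMr //; have := cnorm_ge0 (x - s); have := cnorm_ge0 a; nra.
case: (simA _ idl (@closed_closure _ I)) => [I0|IT].
  have /subset_closure := Ip; rewrite I0 => /= p00.
  by rewrite p00 eqxx in p0.
have /cnorm_closureP /(_ 1 ltr01)[s [u us] s1] : closure I 1 by rewrite IT.
have [g [gs _]] := invertible_near1 s1.
rewrite opprB addrC subrK us mulr_sumr in gs.
exists (size u), (fun i => g * (nth 0 u i).1), (fun i => (nth 0 u i).2).
rewrite -[RHS]gs (big_nth 0) big_mkord; apply: eq_bigr => i _.
by rewrite !mulrA.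
Qed.

Definition property_SP := forall x, positive x -> N x = 1 ->
  exists q, [/\ hereditary x q, is_projection q & q != 0].

(** Elements of the hereditary subalgebra of b ^ 2 are limits of elements
    b c b. *)
Lemma SP_sa b : property_SP -> star b = b -> b != 0 ->
  exists q, [/\ is_projection q, q != 0
    & forall e : R, 0 < e -> exists c, N (q - b * c * b) < e].
Proof.
move=> SP sb b0.
have nb : 0 < N b.
  by rewrite lt_neqAle cnorm_ge0 andbT eq_sym; apply: contra_neq b0; apply: cnorm0_eq0.
pose b' := rs (N b)^-1 * b.
have sb' : star b' = b' by rewrite starM star_rs sb -rsC.
have nb' : N (b' * b') = 1.
  by rewrite cnorm_sa // cnorm_rsM gtr0_norm ?invr_gt0 // mulVf ?gt_eqF // expr1n.
have [q [/cnorm_closureP hq pq q0]] := SP _ (sq_positive sb') nb'.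
exists q; split=> // e /hq[_ [a _ <-] qa].
exists (rs (N b)^-1 * b' * a * (b' * rs (N b)^-1)).
have -> : b * (rs (N b)^-1 * b' * a * (b' * rs (N b)^-1)) * b =
  (b * rs (N b)^-1) * b' * a * (b' * (rs (N b)^-1 * b)) by ncring.
by rewrite -rsC; move: qa; congr (N (_ - _) < e); ncring.
Qed.

(** As z fixes b c b, it moves q by at most (|z| + 1) |q - b c b|. *)
Lemma dominated q b z : (forall e : R, 0 < e -> exists c, N (q - b * c * b) < e) ->
  z * b = b -> z * q = q.
Proof.
move=> qb zb; apply/eqP; rewrite -subr_eq0; apply/eqP.
apply: (@cnorm_eps_eq0 _ (N z + 1)) => e /qb[c qc].
have -> : z * q - q = z * (q - b * c * b) - (q - b * c * b).
  by rewrite mulrBr !mulrA zb; ncring.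
apply: le_trans (cnormB _ _) _; have := ler_cnormM z (q - b * c * b).
have := cnorm_ge0 z; nra.
Qed.

Section Minimal.
Variable p : A.
Hypotheses (hp : is_projection p) (SP : property_SP).
Hypothesis pmin : forall q, is_projection q -> p * q = q -> q != 0 -> q = p.

Let sp : star p = p. Proof. by case: hp. Qed.
Let pp : p * p = p. Proof. by case: hp. Qed.

(** The hereditary subalgebra of b ^ 2 lies in the corner of p, so by minimality
    its nonzero projection is p.  Thus p is close to some b c b, which makes b
    invertible in the corner. *)
Lemma corner_invertible b : star b = b -> p * b = b -> b != 0 ->
  exists j, [/\ b * j = p, j * b = p, p * j = j & j * p = j].
Proof.
move=> sb pb b0; have [q [hq q0 qb]] := SP_sa SP sb b0.
have qp : q = p by apply: pmin => //; apply: dominated qb pb.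
have bp := sa_left_right sp sb pb.
have [c pc] := qb 1 ltr01; rewrite qp in pc.
have [g [_ tg]] := invertible_near1 pc.
have e1 : b * (c * b * g) = p.
  have -> : b * (c * b * g) = (p - (p - b * c * b)) * g by ncring.
  have -> : p - (p - b * c * b) = p * (1 - (p - b * c * b)).
    by rewrite !mulrBr mulr1 pp !mulrA pb.
  by rewrite -mulrA tg mulr1.
have e2 : star (c * b * g) * b = p by rewrite -[in RHS]sp -e1 (starM b) sb.
set k := c * b * g in e1 e2.
have e3 : star k * p = p * k by rewrite -{1}e1 mulrA e2.
exists (p * k); split.
- by rewrite mulrA bp e1.
- by rewrite -e3 -mulrA pb e2.
- by rewrite mulrA pp.
- by rewrite -e3 -mulrA pp.
Qed.

(** The difference |a| p - a vanishes, for otherwise it would be invertible in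
    the corner and |a| - a would be invertible, against [norm_in_spectrum]. *)
Lemma corner_psd a : psd a -> p * a = a -> a = rs (N a) * p.
Proof.
move=> ha pa; have [->|a0] := eqVneq a 0; first by rewrite cnorm0 rs0 mul0r.
have sa := psd_star ha; set t := N a.
have t0 : t != 0 by apply: contra_neq a0; apply: cnorm0_eq0.
apply: contrapT => /eqP; rewrite eq_sym -subr_eq0 => d0.
have [||j [dj jd pj jp]] := corner_invertible _ _ d0.
- by rewrite starB starM star_rs sp sa -rsC.
- by rewrite mulrBr mulrA -rsC -mulrA pp pa.
apply: (norm_in_spectrum ha a0); rewrite -/t.
set d := rs t * p - a in d0 dj jd.
have -> : rs t - a = d + rs t * (1 - p) by rewrite /d; ncring.
have pd : p * d = d by rewrite mulrBr mulrA -rsC -mulrA pp pa.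
have dp : d * p = d by rewrite mulrBl -mulrA pp (sa_left_right sp sa pa).
have tt : rs t * rs t^-1 = 1 by rewrite -rsM divff // rs1.
have tt' : rs t^-1 * rs t = 1 by rewrite -rsM mulVf // rs1.
have p1 : (1 - p) * (1 - p) = 1 - p by rewrite mulrBl !mulrBr pp; ncring.
exists (j + rs t^-1 * (1 - p)); split.
- have -> : (j + rs t^-1 * (1 - p)) * (d + rs t * (1 - p)) =
    j * d + (j * rs t) * (1 - p) + rs t^-1 * (d - p * d) + rs t^-1 * ((1 - p) * rs t) * (1 - p).
    by ncring.
  rewrite -(rsC t j) -(rsC t (1 - p)) jd pd subrr mulr0 addr0 -mulrA mulrBr mulr1 jp subrr.
  by rewrite mulr0 addr0 mulrA tt' mul1r p1; ncring.
have -> : (d + rs t * (1 - p)) * (j + rs t^-1 * (1 - p)) =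
    d * j + (d * rs t^-1) * (1 - p) + rs t * (j - p * j) + rs t * ((1 - p) * rs t^-1) * (1 - p).
  by ncring.
rewrite -(rsC t^-1 d) -(rsC t^-1 (1 - p)) dj pj subrr mulr0 addr0 -mulrA mulrBr mulr1 dp subrr.
by rewrite mulr0 addr0 mulrA tt mul1r p1; ncring.
Qed.

(** Adding |a| p makes a positive. *)
Lemma corner_sa a : star a = a -> p * a = a -> exists l, a = rs l * p.
Proof.
move=> sa pa; set t := N a; have ap := sa_left_right sp sa pa.
have [d sd dd] : psd (a + rs t).
  apply: (@psd_of_norm _ _ _ t); first by rewrite starD sa star_rs.
  by have -> : rs t - (a + rs t) = - a by [ncring]; rewrite cnormN.
have /corner_psd : psd (star (d * p) * (d * p)) by apply: psd_star_mul.
have -> : star (d * p) * (d * p) = a + rs t * p.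
  rewrite starM sp sd; have -> : p * d * (d * p) = p * (d * d) * p by ncring.
  by rewrite dd mulrDr mulrDl pa ap -rsC -mulrA pp.
rewrite mulrDr pa mulrA -rsC -mulrA pp => /(_ erefl) e.
exists (N (a + rs t * p) - t); rewrite rsD rsN mulrDl -e; ncring.
Qed.

Lemma corner_scalar a : exists c : R[i], p * a * p = c *: p.
Proof.
set y := p * a * p; set j := im_unit A.
have py : p * y = y by rewrite /y !mulrA pp.
have psy : p * star y = star y by rewrite /y !starM sp !mulrA pp.
have [l el] : exists l, y + star y = rs l * p.
  by apply: corner_sa; rewrite ?mulrDr ?py ?psy // starD starK addrC.
have [m em] : exists m, j * (star y - y) = rs m * p.
  apply: corner_sa.
    by rewrite starM star_im_unit starB starK mulrN im_unitC -mulrN opprB.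
  by rewrite mulrA im_unitC -mulrA mulrBr py psy.
exists (2^-1 * (l%:C + 'i%C * m%:C)).
(* The decomposition of 2 y into real and imaginary parts. *)
have yy : y + y = (l%:C + 'i%C * m%:C) *: p.
  have -> : y + y = (y + star y) + j * (j * (star y - y)).
    by rewrite mulrA im_unit2; ncring.
  have -> : j * (j * (star y - y)) = ('i%C * m%:C) *: p.
    by rewrite em /j /im_unit /rscalar -!scalerAl !mul1r scalerA.
  by rewrite el /rscalar -scalerAl mul1r scalerDl.
rewrite -scalerA -yy scalerDr -scalerDl; have -> : 2^-1 + 2^-1 = 1 :> R[i] by field.
by rewrite scale1r.
Qed.

End Minimal.

(** If p does not split, its corner consists of the multiples of p.  As
    1 = sum_i a_i p b_i, each x = 1 x 1 is then a combination of the finitely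
    many elements a_i p b_j. *)
Lemma proj_splits p : simple A -> infinite_dimensional A -> property_SP ->
  is_projection p -> p != 0 ->
  exists q, [/\ is_projection q, p * q = q, q != 0 & q != p].
Proof.
move=> simA infA SP hp p0; apply: contrapT => nsplit; apply: infA.
have pmin q : is_projection q -> p * q = q -> q != 0 -> q = p.
  move=> hq pq q0; apply: contrapT => /eqP qp; apply: nsplit; exists q.
  by split.
have [n [a [b ab]]] := full_projection simA p0.
pose e (u : 'I_n * 'I_n) := a u.1 * p * b u.2.
exists #|{: 'I_n * 'I_n}|, (fun i => e (enum_val i)) => x.
have [c hc] := choice (fun u : 'I_n * 'I_n =>
  corner_scalar hp SP pmin (b u.1 * x * a u.2)).
exists (fun i => c (enum_val i)).
rewrite -(big_enum_val (A := {: 'I_n * 'I_n}) (fun u => c u *: e u)) /=.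
rewrite -[LHS]mul1r -[LHS]mulr1 -{1}ab -ab !mulr_suml.
transitivity (\sum_(i < n) \sum_(j < n) c (i, j) *: e (i, j)).
  apply: eq_bigr => i _; rewrite mulr_sumr; apply: eq_bigr => j _.
  rewrite /e /=.
  have -> : c (i, j) *: (a i * p * b j) = a i * (c (i, j) *: p) * b j.
    by rewrite -scalerAr -scalerAl.
  by rewrite -hc /=; ncring.
by rewrite pair_big; apply: eq_bigr => -[i j] _.
Qed.

(** By simplicity y = p a q is nonzero for some a.  Property (SP) gives r <= q
    close to h c h for h = star y * y, that is to star y * z with z = y c h.
    Let d be a square root of y * star y, which exists by [psd_star_mul], and
    w0 = d z r.  Then p w0 = w0 and star w0 * w0 is close to r, so the polar part
    of w0 is the required w. *)
Lemma compare_projections p q : simple A -> property_SP ->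
  is_projection p -> p != 0 -> is_projection q -> q != 0 ->
  exists r w, [/\ is_projection r, r != 0, q * r = r, star w * w = r & p * w = w].
Proof.
move=> simA SP hp p0 hq q0; have [sp pp] := hp; have [sq qq] := hq.
have [n [a' [b' ab]]] := full_projection simA p0.
have [a ya] : exists a, p * a * q != 0.
  apply: contrapT => h; move/eqP: q0; apply.
  rewrite -[q]mulr1 -ab mulr_sumr big1 // => i _.
  have -> : q * (a' i * p * b' i) = star (p * star (a' i) * q) * b' i.
    by rewrite !starM starK sp sq !mulrA.
  have -> : p * star (a' i) * q = 0.
    by apply/eqP; apply: contrapT => /negP hn; apply: h; exists (star (a' i)).
  by rewrite star0 mul0r.
set y := p * a * q in ya; pose h := star y * y.
have sh : star h = h by rewrite starM starK.
have h0 : h != 0.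
  by apply: contra_neq ya; apply: star_mul_eq0.
have [r [hr r0 rh]] := SP_sa SP sh h0; have [sr rr] := hr.
have qy : q * star y = star y by rewrite /y !starM sq !mulrA qq.
have qr : q * r = r by apply: dominated rh _; rewrite mulrA qy.
have [d sd dd] : psd (y * star y) by rewrite -{1}(starK y); apply: psd_star_mul.
(* d inherits its left support p from d ^ 2 = y * star y. *)
have pd : p * d = d.
  have z0 : d * (1 - p) = 0.
    apply: star_mul_eq0.
    have -> : star (d * (1 - p)) * (d * (1 - p)) = (1 - p) * ((y * star y) * (1 - p)).
      by rewrite starM sd starB star1 sp -dd; ncring.
    have yp : star y * p = star y by rewrite /y !starM sp -!mulrA pp.
    by rewrite -mulrA mulrBr mulr1 yp subrr !mulr0.
  have dp : d = d * p by apply/eqP; rewrite -subr_eq0 -{1}[d]mulr1 -mulrBr z0.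
  by rewrite -{2}sd {2}dp starM sp sd.
have [|c hc] := rh (1 / 4); first by lra.
set g0 := h * c * h in hc.
pose w0 := d * (y * c * h) * r.
have ww : star w0 * w0 = r * (star g0 * g0) * r.
  rewrite /w0 !(starM _ r) sr !(starM d) sd.
  set z := y * c * h; have -> : g0 = star y * z by rewrite /g0 /z /h; ncring.
  have -> : r * (star z * d) * (d * z * r) = r * star z * (d * d) * z * r by ncring.
  by rewrite dd (starM (star y) z) starK; ncring.
have small : N (r - star w0 * w0) < 1.
  have nr : N r = 1 by rewrite proj_norm.
  have -> : r - star w0 * w0 = r * (star (r - g0) * r + star g0 * (r - g0)) * r.
    rewrite ww starB sr.
    have -> : r * ((r - star g0) * r + star g0 * (r - g0)) * r =
      (r * r) * (r * r) - r * (star g0 * g0) * r by ncring.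
    by rewrite !rr.
  have ng : N (star g0) <= 5 / 4.
    rewrite cnorm_star; have := cnormB r (r - g0).
    have -> : r - (r - g0) = g0 by ncring.
    rewrite nr; lra.
  have n0 := cnorm_ge0.
  have := ler_cnormD (star (r - g0) * r) (star g0 * (r - g0)).
  have := ler_cnormM (star (r - g0)) r; rewrite nr mulr1 cnorm_star => h1.
  have h2 := @bnormM_le _ _ (cstarBanach A) _ _ _ _ ng (ltW hc : N _ <= _).
  have h2' : N (star g0 * (r - g0)) <= 5 / 4 * (1 / 4) := h2.
  set s := star (r - g0) * r + star g0 * (r - g0) => h3.
  have := ler_cnormM (r * s) r; have := ler_cnormM r s; rewrite nr mul1r mulr1; lra.
have w0r : w0 * r = w0 by rewrite /w0 -mulrA rr.
have [c' [sc cc _]] := @polar_left _ _ (cstarBanach A) _ _ hr w0r small.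
exists r, (w0 * c'); split => //.
by rewrite /w0 !mulrA pd.
Qed.

(** Split s into two pieces and compare them. *)
Lemma proj_halving s : simple A -> infinite_dimensional A -> property_SP ->
  is_projection s -> s != 0 ->
  exists r r', [/\ is_projection r /\ is_projection r', r != 0,
    mvn_equiv r r', r * r' = 0 & s * r = r /\ s * r' = r'].
Proof.
move=> simA infA SP hs s0.
have [q [hq sq q0 qs]] := proj_splits simA infA SP hs s0.
have [[ss s2] [sq' qq]] := (hs, hq).
have qs' := sa_left_right ss sq' sq.
have hp : is_projection (s - q).
  split; first by rewrite starB ss sq'.
  by rewrite mulrBl !mulrBr s2 sq qs' qq subrr subr0.
have p0 : s - q != 0 by rewrite subr_eq0 eq_sym.
have [r [w [hr r0 qr wr pw]]] := compare_projections simA SP hp p0 hq q0.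
have [sr rr] := hr.
have wrw : w * r = w.
  apply/eqP; rewrite -subr_eq0; apply/eqP/star_mul_eq0.
  rewrite starB starM sr.
  have -> : (r * star w - star w) * (w * r - w) = r * (star w * w) * r - r * (star w * w)
    - (star w * w) * r + star w * w by ncring.
  by rewrite wr rr rr; ncring.
exists r, (w * star w); split => //.
- split => //; split; first by rewrite starM starK.
  by rewrite mulrA -(mulrA w) wr wrw.
- by exists w.
- rewrite -(sa_left_right sq' sr qr) -pw -!mulrA (mulrA q) mulrBr qs' qq subrr.
  by rewrite mul0r mulr0.
split; first by rewrite -qr mulrA sq.
by rewrite -pw !mulrA mulrBr s2 sq.
Qed.

End Projections.

(** * Matrix algebras and the order on K_0 *)

Section MatrixAlgebra.
Variables (R : realType) (A : cstarAlgType R) (k : nat).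
Implicit Types (u v w : 'M[A]_k).

(** Not a C*-norm, but submultiplicative and complete. *)
Definition mxnorm u : R := \sum_i \sum_j cnorm (u i j).

Lemma mxnorm_entry u i j : cnorm (u i j) <= mxnorm u.
Proof.
rewrite /mxnorm (bigD1 i) //= (bigD1 j) //= -addrA lerDl addr_ge0 //.
  by apply: sumr_ge0 => *; apply: cnorm_ge0.
by apply: sumr_ge0 => *; apply: sumr_ge0 => *; apply: cnorm_ge0.
Qed.

Lemma mxnorm_le u (c : R) : (forall i j, cnorm (u i j) <= c) ->
  mxnorm u <= k%:R ^+ 2 * c.
Proof.
move=> uc; apply: (@le_trans _ _ (\sum_(i < k) \sum_(j < k) c)).
  by do 2!apply: ler_sum => ? _.
by rewrite !sumr_const !card_ord expr2 -mulrA !mulr_natl.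
Qed.

Lemma mxnormM u v : mxnorm (u * v) <= mxnorm u * mxnorm v.
Proof.
rewrite /mxnorm.
apply: (@le_trans _ _ (\sum_i \sum_j \sum_l cnorm (u i l) * cnorm (v l j))).
  apply: ler_sum => i _; apply: ler_sum => j _; rewrite mxE.
  elim/big_ind2: _ => [|x a y b xa yb|l _]; first by rewrite cnorm0.
    by apply: le_trans (ler_cnormD _ _) _; apply: lerD.
  exact: ler_cnormM.
rewrite mulr_suml; apply: ler_sum => i _; rewrite exchange_big mulr_suml.
apply: ler_sum => l _; rewrite -mulr_sumr ler_wpM2l ?cnorm_ge0 //.
rewrite [leRHS](bigD1 l) //= lerDl.
by apply: sumr_ge0 => *; apply: sumr_ge0 => *; apply: cnorm_ge0.
Qed.

Lemma rs_mxC r u : (rscalar A r)%:M * u = u * (rscalar A r)%:M.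
Proof.
rewrite -!mulmxE mul_scalar_mx -diag_const_mx mul_mx_diag.
by apply/matrixP => i j; rewrite !mxE rsC.
Qed.

Lemma mxcomplete (u : nat -> 'M[A]_k) (b : nat -> R) (c : R) :
  (forall n, mxnorm (u n.+1 - u n) <= b n.+1 - b n) -> (forall n, b n <= c) ->
  exists l, (fun n => mxnorm (u n - l)) @ \oo --> (0 : R).
Proof.
move=> ub bc.
have entry (ij : 'I_k * 'I_k) :
    exists l : A, (fun n => cnorm (u n ij.1 ij.2 - l)) @ \oo --> (0 : R).
  apply: (@ccomplete R A _ b c) => // n; apply: le_trans (ub n).
  by have := mxnorm_entry (u n.+1 - u n) ij.1 ij.2; rewrite !mxE.
have [l ul] := choice entry.
exists (\matrix_(i, j) l (i, j)).
have -> : (fun n => mxnorm (u n - \matrix_(i, j) l (i, j))) =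
  (fun n => \sum_i \sum_j cnorm (u n i j - l (i, j))).
  apply/funext => n; rewrite /mxnorm; apply: eq_bigr => i _.
  by apply: eq_bigr => j _; rewrite !mxE.
have sum0 (F : 'I_k -> nat -> R) : (forall i, F i @ \oo --> (0 : R)) ->
    (fun n => \sum_i F i n) @ \oo --> (0 : R).
  move=> F0; elim: (index_enum 'I_k) => [|i r IH].
    have -> : (fun n => \sum_(i <- [::]) F i n) = fun=> 0.
      by apply/funext => n; rewrite big_nil.
    exact: cvg_cst.
  have -> : (fun n => \sum_(j <- i :: r) F j n) =
      (fun n => F i n + \sum_(j <- r) F j n).
    by apply/funext => n; rewrite big_cons.
  by rewrite -[X in _ --> X]addr0; apply: cvgD.
by apply: (sum0) => i; apply: (sum0) => j; exact: (ul (i, j)).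
Qed.

Definition mxBanach : banachStar R 'M[A]_k.
Proof.
exists mxnorm (@mxstar R A k k) (rscalar A 2^-1)%:M.
- move=> u v; rewrite /mxnorm -big_split; apply: ler_sum => i _.
  rewrite -big_split; apply: ler_sum => j _; rewrite mxE; exact: ler_cnormD.
- move=> u; rewrite /mxnorm; apply: eq_bigr => i _; apply: eq_bigr => j _.
  by rewrite mxE cnormN.
- move=> u u0; apply/matrixP => i j; rewrite mxE; apply: cnorm0_eq0.
  apply/eqP; rewrite eq_le cnorm_ge0 andbT.
  by rewrite -u0; exact: mxnorm_entry.
- exact: mxnormM.
- by move=> u v; apply/matrixP => i j; rewrite !mxE starD.
- exact: mxstarM.
- exact: mxstarK.
- move=> u; rewrite /mxnorm exchange_big; apply: eq_bigr => i _.
  by apply: eq_bigr => j _; rewrite mxE cnorm_star.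
- rewrite -raddfD -rsD; have -> : 2^-1 + 2^-1 = 1 :> R by field.
  by rewrite rs1.
- exact: rs_mxC.
- move=> u; rewrite /mxnorm mulr_suml le_eqVlt; apply/orP; left; apply/eqP.
  apply: eq_bigr => i _; rewrite mulr_suml; apply: eq_bigr => j _.
  rewrite -mulmxE mul_scalar_mx mxE cnorm_rsM ger0_norm ?invr_ge0 ?ler0n //.
  by rewrite mulrC.
- exact: mxcomplete.
Defined.

End MatrixAlgebra.

Section K0Order.
Variables (R : realType) (A : cstarAlgType R).

Lemma K0_class_mvn m n (p : 'M[A]_m) (q : 'M[A]_n)
    (hp : mx_projection p) (hq : mx_projection q) :
  mx_mvn p q -> K0_class hp = K0_class hq.
Proof. by move=> pq; congr groth_of; apply/mvnV_classP. Qed.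

(** The class of a projection as a total function, which spares the proofs. *)
Definition kclass n (p : 'M[A]_n) : K0 A :=
  if pselect (mx_projection p) is left hp then K0_class hp else 0.

Lemma kclassE n (p : 'M[A]_n) (hp : mx_projection p) : kclass p = K0_class hp.
Proof.
rewrite /kclass; case: pselect => // hp'; apply: K0_class_mvn.
exact: mx_mvn_refl.
Qed.

Lemma kclass_mvn m n (p : 'M[A]_m) (q : 'M[A]_n) :
  mx_projection p -> mx_projection q -> mx_mvn p q -> kclass p = kclass q.
Proof. by move=> hp hq pq; rewrite !kclassE; apply: K0_class_mvn. Qed.

Lemma kclass_dsum m n (p : 'M[A]_m) (q : 'M[A]_n) :
  mx_projection p -> mx_projection q ->
  kclass (dsum_mx p q) = kclass p + kclass q.
Proof.
move=> hp hq; rewrite (kclassE hp) (kclassE hq) (kclassE (dsum_projection hp hq)).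
by rewrite /K0_class -mvnV_classD /groth_of [RHS]groth_diffD addr0.
Qed.

Lemma kclass0 n : kclass (0 : 'M[A]_n) = 0.
Proof.
have z0 : kclass (0 : 'M[A]_0) = 0 by rewrite (kclassE (mx_projection0 A 0)).
rewrite -z0; apply: kclass_mvn; [exact: mx_projection0|exact: mx_projection0|].
by exists 0; rewrite !mulmx0 !mul0mx.
Qed.

Lemma kclassD n (p q : 'M[A]_n) : mx_projection p -> mx_projection q ->
  p *m q = 0 -> kclass (p + q) = kclass p + kclass q.
Proof.
move=> hp hq pq; have [[sp pp] [sq qq]] := (hp, hq).
have qp : q *m p = 0 by rewrite -sp -sq -mxstarM pq mxstar0.
have hpq : mx_projection (p + q).
  exact: (@sprojD _ _ (mxBanach A n) p q hp hq pq).
rewrite -kclass_dsum //; apply: kclass_mvn => //; first exact: dsum_projection.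
apply: mx_mvn_sym; exists (row_mx p q).
have -> : mxstar (row_mx p q) = col_mx p q.
  apply/matrixP => i j; rewrite mxE -(fintype.splitK i).
  case: (fintype.split i) => i' /=.
    by rewrite row_mxEl col_mxEu -[in RHS]sp mxE.
  by rewrite row_mxEr col_mxEd -[in RHS]sq mxE.
by rewrite mul_col_row mul_row_col pp qq pq qp.
Qed.

Lemma K0_le_class n (p : 'M[A]_n) : mx_projection p -> K0_le 0 (kclass p).
Proof. by move=> hp; exists n, p, hp; rewrite subr0 kclassE. Qed.

Lemma K0_le_sub (x y : K0 A) : K0_le 0 (y - x) <-> K0_le x y.
Proof. by rewrite /K0_le subr0. Qed.

Lemma K0_ge0D (x y : K0 A) : K0_le 0 x -> K0_le 0 y -> K0_le 0 (x + y).
Proof.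
move=> [m [p [hp]]]; rewrite subr0 -kclassE => ->.
move=> [n [q [hq]]]; rewrite subr0 -kclassE => ->.
by rewrite -kclass_dsum //; apply/K0_le_class/dsum_projection.
Qed.

Lemma K0_le_refl (x : K0 A) : K0_le x x.
Proof.
by apply/K0_le_sub; have := K0_le_class (mx_projection0 A 0); rewrite kclass0 subrr.
Qed.

Lemma K0_leD (x y z t : K0 A) : K0_le x y -> K0_le z t -> K0_le (x + z) (y + t).
Proof.
move=> /K0_le_sub xy /K0_le_sub zt; apply/K0_le_sub.
by rewrite opprD addrACA; apply: K0_ge0D.
Qed.

Lemma K0_le_trans (y x z : K0 A) : K0_le x y -> K0_le y z -> K0_le x z.
Proof.
move=> /K0_le_sub xy /K0_le_sub yz; apply/K0_le_sub.
by rewrite -(subrK y z) -addrA; apply: K0_ge0D.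
Qed.

Lemma K0_leN (x y : K0 A) : K0_le x y -> K0_le (- y) (- x).
Proof. by move=> /K0_le_sub h; apply/K0_le_sub; rewrite opprK addrC. Qed.

Lemma K0_leMn (x y : K0 A) n : K0_le x y -> K0_le (x *+ n) (y *+ n).
Proof.
move=> xy; elim: n => [|n IH]; first by rewrite !mulr0n; apply: K0_le_refl.
by rewrite !mulrS; apply: K0_leD.
Qed.

Lemma K0_le_Mn (x : K0 A) m n : K0_le 0 x -> (m <= n)%N -> K0_le (x *+ m) (x *+ n).
Proof.
move=> x0 mn; apply/K0_le_sub; rewrite -mulrnBr //.
by have := K0_leMn (n - m) x0; rewrite mul0rn.
Qed.

Lemma K0_le_map (alpha : starAut A) (x y : K0 A) :
  K0_le x y -> K0_le (K0_map alpha x) (K0_map alpha y).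
Proof.
move=> [n [p [hp e]]]; exists n, (map_mx alpha p), (map_projection alpha hp).
by rewrite -K0_map_class -e raddfB.
Qed.

Lemma kclass_map (alpha : starAut A) n (p : 'M[A]_n) : mx_projection p ->
  K0_map alpha (kclass p) = kclass (map_mx alpha p).
Proof.
by move=> hp; rewrite (kclassE hp) K0_map_class -kclassE.
Qed.

Lemma kclass_subprojection n (p q : 'M[A]_n) :
  mx_projection p -> mx_projection q -> p *m q = q ->
  K0_le (kclass q) (kclass p).
Proof.
move=> hp hq pq; have [[sp pp] [sq qq]] := (hp, hq).
have qp : q *m p = q by rewrite -sp -sq -mxstarM pq.
have hd : mx_projection (p - q).
  split; first by rewrite -[LHS]/(bstar (mxBanach A n) (p - q)) bstarB /= sp sq.
  by rewrite mulmxBl !mulmxBr pp pq qp qq subrr subr0.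
apply/K0_le_sub; have -> : kclass p - kclass q = kclass (p - q).
  have e : (p - q) *m q = 0 by rewrite mulmxBl pq qq subrr.
  by rewrite -[in kclass p](subrK q p) (kclassD hd hq e) addrK.
exact: K0_le_class.
Qed.

Lemma scalar_projection k (p : A) : is_projection p ->
  mx_projection (p%:M : 'M[A]_k).
Proof.
move=> [sp pp]; split; last by rewrite -scalar_mxM pp.
by apply/matrixP => i j; rewrite !mxE eq_sym; case: eqP => _; rewrite ?mulr1n ?mulr0n ?star0.
Qed.

Lemma mxstar_scalar k (a : A) : mxstar (a%:M : 'M[A]_k) = (star a)%:M.
Proof.
by apply/matrixP => i j; rewrite !mxE eq_sym; case: eqP => _; rewrite ?mulr1n ?mulr0n ?star0.
Qed.

Lemma scalar_mvn k (p q : A) : mvn_equiv p q -> mx_mvn (p%:M : 'M[A]_k) (q%:M : 'M[A]_k).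
Proof.
by move=> [w [wp wq]]; exists w%:M; rewrite mxstar_scalar -!scalar_mxM wp wq.
Qed.

Definition eclass (p : A) : K0 A := kclass (p%:M : 'M[A]_1).

Lemma eclass1 : eclass 1 = K0_unit A.
Proof. by rewrite /eclass (kclassE (mx_projection1 A 1)). Qed.

Lemma kclass_scalar k (p : A) : is_projection p ->
  kclass (p%:M : 'M[A]_k) = eclass p *+ k.
Proof.
move=> hp; elim: k => [|k IH].
  by rewrite mulr0n -(kclass0 0); congr kclass; apply/matrixP => -[].
rewrite mulrS -IH -kclass_dsum; [|exact: scalar_projection..].
by congr kclass; rewrite -[k.+1]/(1 + k)%N scalar_mx_block.
Qed.

Lemma eclass_mvn (p q : A) : is_projection p -> is_projection q ->
  mvn_equiv p q -> eclass p = eclass q.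
Proof.
move=> hp hq pq; apply: kclass_mvn; [exact: scalar_projection..|exact: scalar_mvn].
Qed.

Lemma eclass_subprojection (p q : A) : is_projection p -> is_projection q ->
  p * q = q -> K0_le (eclass q) (eclass p).
Proof.
move=> hp hq pq; apply: kclass_subprojection; [exact: scalar_projection..|].
by rewrite -scalar_mxM pq.
Qed.

Lemma eclassD (p q : A) : is_projection p -> is_projection q ->
  p * q = 0 -> eclass (p + q) = eclass p + eclass q.
Proof.
move=> hp hq pq; rewrite /eclass raddfD kclassD //; [exact: scalar_projection..|].
by rewrite -scalar_mxM pq raddf0.
Qed.

Lemma K0_le_eclass (p : A) : is_projection p -> K0_le 0 (eclass p).
Proof. by move=> hp; apply/K0_le_class/scalar_projection. Qed.

Lemma proj1 : is_projection (1 : A).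
Proof. by split; rewrite ?star1 ?mulr1. Qed.

(** Iterate [proj_halving], starting from the unit. *)
Lemma dyadic_projection j : simple A -> infinite_dimensional A -> property_SP A ->
  exists s : A, [/\ is_projection s, s != 0 & K0_le (eclass s *+ 2 ^ j) (K0_unit A)].
Proof.
move=> simA infA SP; elim: j => [|j [s [hs s0 hle]]].
  exists 1; split; [exact: proj1|exact: oner_neq0|].
  by rewrite eclass1; apply: K0_le_refl.
have [r [r' [[hr hr'] r0 rr' orth [sr sr']]]] := proj_halving simA infA SP hs s0.
exists r; split => //; apply: K0_le_trans hle.
rewrite expnS mulrnA; apply: K0_leMn.
rewrite mulr2n {2}(eclass_mvn hr hr' rr') -eclassD //.
apply: eclass_subprojection => //; last by rewrite mulrDr sr sr'.
exact: (@sprojD _ _ (cstarBanach A) r r' hr hr' orth).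
Qed.

(** Without property (SP), some hereditary subalgebra has no projection but 0.
    With it, take for x a projection as in [dyadic_projection]: the projections
    in its hereditary subalgebra are its subprojections. *)
Lemma small_positive m : simple A -> infinite_dimensional A ->
  exists x : A, [/\ positive x, cnorm x = 1
    & forall q, hereditary x q -> is_projection q ->
      K0_le (eclass q *+ m) (K0_unit A)].
Proof.
move=> simA infA; have [SP|nSP] := pselect (property_SP A); last first.
  have [x hx] : exists x : A, ~ (positive x -> cnorm x = 1 ->
      exists q, [/\ hereditary x q, is_projection q & q != 0]).
    by apply: contrapT => h; apply: nSP => x; apply: contrapT => hx; apply: h; exists x.
  have [xpos /not_implyP[x1 hx2]] := (not_implyP _ _).1 hx.
  exists x; split => // q hq pq.
  have [->|q0] := eqVneq q 0; last by case: hx2; exists q.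
  rewrite /eclass raddf0 kclass0 mul0rn -eclass1; apply: K0_le_eclass; exact: proj1.
have [s [hs s0 hle]] := dyadic_projection m simA infA SP.
have [ss s2] := hs.
exists s; split; [by rewrite -s2; apply: sq_positive|exact: proj_norm|].
move=> q /cnorm_closureP hq pq; apply: K0_le_trans hle.
apply: (@K0_le_trans (eclass s *+ m)).
  apply/K0_leMn/eclass_subprojection => //.
  apply: (@dominated _ _ q s) s2 => e /hq[_ [a _ <-]]; by exists a.
apply: K0_le_Mn; first exact: K0_le_eclass.
by apply: ltnW; apply: ltn_expl.
Qed.

End K0Order.

(** * The displacement of a projection class *)

Section Displacement.
Variables (R : realType) (A : cstarAlgType R) (alpha : starAut A).
Local Notation N := (bnorm (mxBanach A _)).

Lemma mxnorm_map k (u : 'M[A]_k) : mxnorm (map_mx alpha u) <= mxnorm u.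
Proof.
apply: ler_sum => i _; apply: ler_sum => j _; rewrite mxE.
exact: starAut_contraction.
Qed.

Lemma mxnorm_scalar k (a : A) : cnorm a <= 1 -> mxnorm (a%:M : 'M[A]_k) <= k%:R ^+ 2.
Proof.
move=> a1; rewrite -[leRHS]mulr1; apply: mxnorm_le => i j; rewrite mxE.
by case: eqP => _; rewrite ?mulr1n // mulr0n cnorm0.
Qed.

Lemma scalar_mx_mulE k (a b : A) (u : 'M[A]_k) i j :
  (a%:M *m u *m b%:M) i j = a * u i j * b.
Proof.
by rewrite mul_scalar_mx -diag_const_mx mul_mx_diag !mxE.
Qed.

(** [split_projection] for the diagonal projection with entries p. *)
Lemma compression_classes k (e : 'M[A]_k) p (C d : R) :
  mx_projection e -> is_projection p ->
  1 <= C -> k%:R ^+ 2 <= C -> mxnorm e <= C ->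
  mxnorm (p%:M *m e - e *m p%:M) <= d -> 104 * C ^+ 9 * d < 1 ->
  exists f g : 'M[A]_k,
    [/\ [/\ mx_projection f, mx_projection g, p%:M *m f = f
           & (1 - p)%:M *m g = g],
      mxnorm (f - p%:M *m e *m p%:M) <= 12 * C ^+ 7 * d,
      mxnorm f <= 2 * C ^+ 3 & kclass e = kclass f + kclass g].
Proof.
move=> he hp C1 kC eC pe small.
have hP : mx_projection (p%:M : 'M[A]_k) := scalar_projection k hp.
have P'E : 1 - p%:M = (1 - p)%:M :> 'M[A]_k by rewrite raddfB.
have scalC a : cnorm a <= 1 -> mxnorm (a%:M : 'M[A]_k) <= C.
  by move=> a1; apply: le_trans kC; apply: mxnorm_scalar.
have nP := scalC _ (proj_norm_le1 hp).
have [f [g [[hf hg pf pg] fn [w [we wf]]]]] :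
   exists f g : 'M[A]_k,
     [/\ [/\ mx_projection f, mx_projection g, p%:M * f = f & p%:M * g = 0],
     mxnorm (f - p%:M * e * p%:M) <= 12 * C ^+ 7 * d
     & exists v, mxstar v * v = e /\ v * mxstar v = f + g].
  apply: (@split_projection _ _ (mxBanach A k) e p%:M C d he hP C1 _ eC nP _ pe small).
  - by apply: scalC; rewrite cnorm1.
  - rewrite P'E; apply: scalC; apply: proj_norm_le1; exact: proj_compl.
exists f, g; split=> //.
- by split=> //; rewrite -P'E mulmxBl mul1mx [_ *m g]pg subr0.
- have nPeP : mxnorm (p%:M * e * p%:M) <= C ^+ 3.
    rewrite exprSr expr2.
    by do !apply: (@bnormM_le _ _ (mxBanach A k)) => //.
  have : mxnorm f <= mxnorm (f - p%:M * e * p%:M) + mxnorm (p%:M * e * p%:M).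
    rewrite -[in leLHS](subrK (p%:M * e * p%:M) f).
    exact: (ler_bnormD (mxBanach A k)).
  have d0 : 0 <= d by apply: le_trans pe; apply: (bnorm_ge0 (mxBanach A k)).
  have C3 : 1 <= C ^+ 3 by apply: exprn_ege1.
  have m7 : C ^+ 7 * d <= C ^+ 9 * d by apply: ler_wpM2r => //; apply: ler_weXn2l.
  have m0 : 0 <= C ^+ 9 * d by rewrite mulr_ge0 // exprn_ge0 // (le_trans ler01).
  lra.
have fg : f *m g = 0.
  have fp : f *m p%:M = f.
    by case: hf hP => sf _ [sp _]; rewrite -{1}sf -{1}sp -mxstarM [_ *m f]pf sf.
  by rewrite -fp -mulmxA [_ *m g]pg mulmx0.
rewrite -kclassD //; apply: kclass_mvn => //.
  exact: (@sprojD _ _ (mxBanach A k) f g hf hg fg).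
by exists w.
Qed.

(** The distance from v f1 star v to alpha f2 is estimated through
    v p1 e p1 star v and alpha (p2 e p2). *)
Lemma compressions_equivalent k (e f1 f2 : 'M[A]_k) (p1 p2 v : A) (C d : R) :
  is_projection p1 -> is_projection p2 ->
  star v * v = p1 -> v * star v = alpha p2 ->
  mx_projection f1 -> mx_projection f2 ->
  p1%:M *m f1 = f1 -> p2%:M *m f2 = f2 ->
  1 <= C -> k%:R ^+ 2 <= C -> mxnorm f1 <= 2 * C ^+ 3 -> mxnorm f2 <= 2 * C ^+ 3 ->
  mxnorm (f1 - p1%:M *m e *m p1%:M) <= 12 * C ^+ 7 * d ->
  mxnorm (f2 - p2%:M *m e *m p2%:M) <= 12 * C ^+ 7 * d ->
  mxnorm ((v * p1)%:M *m e *m (p1 * star v)%:M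
          - map_mx alpha (p2%:M *m e *m p2%:M)) <= d ->
  400 * C ^+ 21 * d < 1 ->
  kclass (map_mx alpha f2) = kclass f1.
Proof.
move=> hp1 hp2 vp1 vp2 hf1 hf2 pf1 pf2 C1 kC f1C f2C fn1 fn2 conj small.
have scalC a : cnorm a <= 1 -> mxnorm (a%:M : 'M[A]_k) <= C.
  by move=> a1; apply: le_trans kC; apply: mxnorm_scalar.
have hpa : is_projection (alpha p2).
  by case: hp2 => sp pp; split; rewrite -?starAut_star -?rmorphM ?sp ?pp.
have v1 : cnorm v <= 1.
  have := cnorm_starM v; rewrite vp1 => h; have := proj_norm_le1 hp1.
  by rewrite h expr_le1 ?cnorm_ge0.
have d0 : 0 <= d by apply: le_trans conj; apply: (bnorm_ge0 (mxBanach A k)).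
have Cmono i j : (i <= j)%N -> C ^+ i * d <= C ^+ j * d.
  by move=> ij; apply: ler_wpM2r => //; apply: ler_weXn2l.
apply: kclass_mvn => //; first exact: map_projection.
apply: mx_mvn_sym.
pose V : 'M[A]_k := v%:M.
pose P1 : 'M[A]_k := p1%:M; pose P2 : 'M[A]_k := p2%:M.
pose rho := 25 * (C ^+ 9 * d).
have Vrho : mxnorm (V * f1 * mxstar V - map_mx alpha f2) <= rho.
  have -> : V * f1 * mxstar V - map_mx alpha f2 =
      V * (f1 - P1 * e * P1) * mxstar V
      + (V * P1 * e * (P1 * mxstar V) - map_mx alpha (P2 * e * P2))
      + (map_mx alpha (P2 * e * P2) - map_mx alpha f2) by ncring.
  have t1 : mxnorm (V * (f1 - P1 * e * P1) * mxstar V) <= C * (12 * C ^+ 7 * d) * C.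
    have vC : mxnorm V <= C by apply: scalC.
    have vC' : mxnorm (mxstar V) <= C.
      by apply: le_trans vC; rewrite [leLHS](bnorm_star (mxBanach A k) V).
    by do !apply: (@bnormM_le _ _ (mxBanach A k)).
  have t2 : mxnorm (V * P1 * e * (P1 * mxstar V) - map_mx alpha (P2 * e * P2)) <= d.
    by rewrite /V /P1 /P2 mxstar_scalar -!mulmxE -!scalar_mxM.
  have t3 : mxnorm (map_mx alpha (P2 * e * P2) - map_mx alpha f2) <= 12 * C ^+ 7 * d.
    rewrite -map_mxB; apply: le_trans (mxnorm_map _) _.
    by rewrite [leLHS](bnormBC (mxBanach A k)).
  apply: le_trans (ler_bnormD (mxBanach A k) _ _) _.
  apply: le_trans (lerD (ler_bnormD (mxBanach A k) _ _) t3) _.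
  apply: le_trans (lerD (lerD t1 t2) (lexx _)) _.
  have m7 := Cmono 7%N 9%N isT; have := Cmono 0%N 9%N isT; rewrite expr0 mul1r => m0.
  have -> : C * (12 * C ^+ 7 * d) * C = 12 * (C ^+ 9 * d) by ring.
  rewrite /rho; lra.
have C33 : C <= 2 * C ^+ 3.
  have := @ler_weXn2l _ C C1 1 3 isT; rewrite expr1.
  have : 1 <= C ^+ 3 by apply: exprn_ege1.
  lra.
have [w [w1 w2]] : exists w : 'M[A]_k, mxstar w * w = f1 /\ w * mxstar w = map_mx alpha f2.
  apply: (@conjugate_projections _ _ (mxBanach A k) f1 (map_mx alpha f2)
     P1 (alpha p2)%:M V (2 * C ^+ 3) rho) => //.
  - exact: map_projection.
  - exact: scalar_projection.
  - by rewrite /V /= mxstar_scalar -mulmxE -scalar_mxM vp1.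
  - by rewrite /V /= mxstar_scalar -mulmxE -scalar_mxM vp2.
  - by rewrite -mulmxE -map_scalar_mx -map_mxM pf2.
  - by apply: le_trans f2C; apply: mxnorm_map.
  - by apply: le_trans C33; apply: scalC.
  - have -> : (2 * C ^+ 3) ^+ 4 * rho = 400 * C ^+ 21 * d by rewrite /rho; ring.
    exact: small.
  - have -> : (2 * C ^+ 3) ^+ 2 * rho = 100 * (C ^+ 15 * d) by rewrite /rho; ring.
    have m21 := Cmono 15%N 21%N isT.
    have m0 : 0 <= C ^+ 15 * d by rewrite mulr_ge0 // exprn_ge0 // (le_trans ler01).
    lra.
by exists w.
Qed.

(** [e] = [f_i] + [g_i] for i = 1, 2 and alpha_*[f_2] = [f_1], so that only the
    parts g_i below 1 - p_i contribute to the displacement. *)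
Lemma displacement_bounds k (e : 'M[A]_k) (x : A) :
  tracially_approximately_inner alpha -> mx_projection e ->
  positive x -> cnorm x = 1 ->
  exists q1 q2, [/\ hereditary x q1 /\ is_projection q1,
    hereditary x q2 /\ is_projection q2,
    K0_le (- (eclass q1 *+ k)) (K0_map alpha (kclass e) - kclass e)
    & K0_le (K0_map alpha (kclass e) - kclass e) (K0_map alpha (eclass q2 *+ k))].
Proof.
move=> tai he xpos x1.
pose C : R := 1 + k%:R ^+ 2 + mxnorm e.
have k2 : 0 <= (k%:R : R) ^+ 2 by rewrite exprn_ge0.
have ne : 0 <= mxnorm e := bnorm_ge0 (mxBanach A k) e.
have C1 : 1 <= C by rewrite /C; lra.
have kC : k%:R ^+ 2 <= C by rewrite /C; lra.
have eC : mxnorm e <= C by rewrite /C; lra.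
(* With d = C * eps both smallness conditions become bounds on C ^+ 22 * eps. *)
pose eps : R := (401 * C ^+ 22)^-1.
have C22 : 1 <= C ^+ 22 by apply: exprn_ege1.
have eps0 : 0 < eps by rewrite invr_gt0; lra.
have epsC : C ^+ 22 * eps = 401^-1 by rewrite /eps; field; lra.
pose F := [set a | exists ij : 'I_k * 'I_k, a = e ij.1 ij.2].
have finF : finite_set F.
  have -> : F = [set e ij.1 ij.2 | ij in [set: 'I_k * 'I_k]].
    by apply/seteqP; split=> [a [ij ->]|_ [ij _ <-]]; exists ij.
  exact/finite_image/finite_finset.
have [p1 [p2 [v [[hp1 hp2 vp1 vp2] comm conj [q1 [q2 [hq1 hq2 eq1 eq2]]] _]]]] :=
  tai F eps x finF eps0 xpos x1.
have Fe i j : F (e i j) by exists (i, j).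
exists q1, q2.
suff [lo up] : K0_le (- (eclass q1 *+ k)) (K0_map alpha (kclass e) - kclass e) /\
    K0_le (K0_map alpha (kclass e) - kclass e) (K0_map alpha (eclass q2 *+ k)).
  by split.
pose d := C * eps.
have smallf : 400 * C ^+ 21 * d < 1.
  have -> : 400 * C ^+ 21 * d = 400 * (C ^+ 22 * eps) by rewrite /d; ring.
  rewrite epsC; lra.
have smalle : 104 * C ^+ 9 * d < 1.
  have m : C ^+ 10 * eps <= C ^+ 22 * eps.
    by rewrite ler_wpM2r ?(ltW eps0) //; apply: ler_weXn2l.
  have -> : 104 * C ^+ 9 * d = 104 * (C ^+ 10 * eps) by rewrite /d; ring.
  rewrite epsC in m; lra.
have entry_le (u : 'M[A]_k) : (forall i j, cnorm (u i j) <= eps) -> mxnorm u <= d.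
  move=> h; apply: le_trans (mxnorm_le h) _; apply: ler_wpM2r => //; exact: ltW.
have cut_by p : is_projection p -> (forall i j, cnorm (p * e i j - e i j * p) < eps) ->
    exists f g : 'M[A]_k,
      [/\ [/\ mx_projection f, mx_projection g, p%:M *m f = f
             & (1 - p)%:M *m g = g],
        mxnorm (f - p%:M *m e *m p%:M) <= 12 * C ^+ 7 * d,
        mxnorm f <= 2 * C ^+ 3 & kclass e = kclass f + kclass g].
  move=> hp pe; apply: compression_classes => //.
  apply: entry_le => i j; apply/ltW.
  rewrite mul_scalar_mx -diag_const_mx mul_mx_diag !mxE; exact: pe.
have [f1 [g1 [[hf1 hg1 pf1 pg1] fn1 f1C e1]]] := cut_by p1 hp1 (fun i j => (comm _ (Fe i j)).1).
have [f2 [g2 [[hf2 hg2 pf2 pg2] fn2 f2C e2]]] := cut_by p2 hp2 (fun i j => (comm _ (Fe i j)).2).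
have f12 : kclass (map_mx alpha f2) = kclass f1.
  apply: (compressions_equivalent hp1 hp2 vp1 vp2 hf1 hf2 pf1 pf2 C1 kC f1C f2C fn1 fn2 _ smallf).
  apply: entry_le => i j; apply/ltW; have := conj _ (Fe i j); congr (cnorm _ < _).
  rewrite mxE scalar_mx_mulE [X in _ = _ + X]mxE [X in _ = _ - X]mxE.
  by rewrite scalar_mx_mulE !mulrA.
have D : K0_map alpha (kclass e) - kclass e = K0_map alpha (kclass g2) - kclass g1.
  by rewrite {1}e2 raddfD /= (kclass_map alpha hf2) f12 e1 opprD addrACA subrr add0r.
have bound p q (g : 'M[A]_k) : is_projection p -> is_projection q -> mvn_equiv (1 - p) q ->
    mx_projection g -> (1 - p)%:M *m g = g -> K0_le (kclass g) (eclass q *+ k).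
  move=> hp hq eqv hg pg.
  rewrite -(eclass_mvn (proj_compl hp) hq eqv) -(kclass_scalar k (proj_compl hp)).
  by apply: kclass_subprojection => //; apply/scalar_projection/proj_compl.
have b1 := bound _ _ _ hp1 hq1.2 eq1 hg1 pg1.
have b2 := bound _ _ _ hp2 hq2.2 eq2 hg2 pg2.
rewrite D; split.
  rewrite -[- (eclass q1 *+ k)]add0r; apply: K0_leD; last exact: K0_leN.
  by have := K0_le_map alpha (K0_le_class hg2); rewrite raddf0.
rewrite -[K0_map alpha (_ *+ k)]addr0; apply: K0_leD; first exact: K0_le_map.
by have := K0_leN (K0_le_class hg1); rewrite oppr0.
Qed.

Lemma alpha_kclass1 k : K0_map alpha (kclass (1%:M : 'M[A]_k)) = kclass (1%:M : 'M[A]_k).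
Proof. by rewrite (kclass_map alpha (mx_projection1 A k)) map_mx1. Qed.

(** For eta = [p] - [q] take e = p (+) (1 - q): then [e] = eta + [1_n], and alpha
    fixes [1_n]. *)
Lemma displacement_of_projection (eta : K0 A) :
  exists k (e : 'M[A]_k), mx_projection e /\
    K0_map alpha eta - eta = K0_map alpha (kclass e) - kclass e.
Proof.
have [m [n [p [hp [q [hq ->]]]]]] := K0_diff eta.
have h1 := mx_projection1 A n.
have hq' : mx_projection (1%:M - q) := sproj_compl (T := mxBanach A n) hq.
exists (m + n)%N, (dsum_mx p (1%:M - q)); split; first exact: dsum_projection.
have e1 : kclass (1%:M : 'M[A]_n) = kclass q + kclass (1%:M - q).
  rewrite -kclassD //; first by rewrite addrC subrK.
  by case: hq => _ qq; rewrite mulmxBr mulmx1 qq subrr.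
have -> : kclass (dsum_mx p (1%:M - q)) = K0_class hp - K0_class hq + kclass (1%:M : 'M[A]_n).
  by rewrite kclass_dsum // e1 -(kclassE hp) -(kclassE hq) addrA subrK.
move: (_ - K0_class hq) => zeta.
by rewrite raddfD /= alpha_kclass1 opprD addrACA subrr addr0.
Qed.

End Displacement.

Theorem proposition6p2 (R : realType) (A : cstarAlgType R)
    (infA : infinite_dimensional A) (simA : simple A) (sepA : separable A)
    (alpha : starAut A) (innA : tracially_approximately_inner alpha)
    (eta : K0 A) :
  infinitesimal (K0_map alpha eta - eta).
Proof.
move=> m n m0; have [k [e [he ->]]] := displacement_of_projection alpha eta.
have [x [xpos x1 hx]] := small_positive (k * n) simA infA.
have [q1 [q2 [[h1 p1] [h2 p2] lo up]]] := displacement_bounds innA he xpos x1.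
have u0 : K0_le 0 (K0_unit A) by rewrite -eclass1; apply/K0_le_eclass/proj1.
have um : K0_le (K0_unit A) (K0_unit A *+ m).
  by rewrite -{1}[K0_unit A]mulr1n; apply: K0_le_Mn.
have au : K0_map alpha (K0_unit A) = K0_unit A.
  by rewrite -eclass1; apply: alpha_kclass1.
split.
  apply: K0_le_trans (K0_leMn n lo); rewrite mulNrn -mulrnA; apply: K0_leN.
  exact: K0_le_trans (hx _ h1 p1) um.
apply: K0_le_trans (K0_leMn n up) _; rewrite -raddfMn -mulrnA.
apply: K0_le_trans (K0_le_map alpha (hx _ h2 p2)) _.
by rewrite au.
Qed.
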